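(* Let $X$ be a compact metric space with metric $d$, $T:X\to X$ continuous, and $\Phi=\{\phi_n\}_{n\ge1}$ a supadditive potential on $X$. Then for every ergodic $T$-invariant Borel probability measure $\mu$, \[ P^*_\mu(T,\Phi)=\underline{CP}^*_\mu(T,\Phi)=\overline{CP}^*_\mu(T,\Phi)=P_\mu(T,\Phi)=h_\mu(T)+\Phi_*(\mu). \]
   Context: $h_\mu(T)$ is the measure-theoretic entropy. $d_n(x,y)=\max_{0\le i\le n-1}d(T^ix,T^iy)$, $B_n(x,\epsilon)=\{y:d_n(x,y)<\epsilon\}$. A supadditive potential is a sequence of continuous $\phi_n:X\to\mathbb{R}$ with $\phi_{n+m}(x)\ge\phi_n(x)+\phi_m(T^nx)$ for all $x$, $n,m\ge1$; $\Phi_*(\mu)=\lim_n\frac1n\int\phi_nd\mu=\sup_n\frac1n\int\phi_nd\mu$. Spanning pressure: for $0<\delta<1$, $F\subseteq X$ is $(n,\epsilon,\delta)$-spanning if $\mu(\bigcup_{x\in F}B_n(x,\epsilon))\ge1-\delta$; $P_\mu(T,\Phi,n,\epsilon,\delta)=\inf\{\sum_{x\in F}e^{\phi_n(x)}:F\ (n,\epsilon,\delta)\text{-spanning}\}$; $P_\mu(T,\Phi,\epsilon,\delta)=\limsup_{n\to\infty}\frac1n\log P_\mu(T,\Phi,n,\epsilon,\delta)$; $P_\mu(T,\Phi,\delta)=\lim_{\epsilon\to0}P_\mu(T,\Phi,\epsilon,\delta)$; $P_\mu(T,\Phi)=\lim_{\delta\to0}P_\mu(T,\Phi,\delta)$.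 Carathéodory pressure: for $Z\subseteq X$, $\epsilon>0$, a cover of $Z$ is a countable family $\Gamma=\{B_{n_i}(x_i,\epsilon)\}$ covering $Z$, $n(\Gamma)=\min n_i$; $M(Z,\Phi,s,N,\epsilon)=\inf_\Gamma\sum_i\exp(-sn_i+\phi_{n_i}(x_i))$ over covers with $n(\Gamma)\ge N$; $m(Z,\Phi,s,\epsilon)=\lim_NM(Z,\Phi,s,N,\epsilon)$; $P_Z(T,\Phi,\epsilon)=\inf\{s:m(Z,\Phi,s,\epsilon)=0\}=\sup\{s:m=+\infty\}$; $P_Z(T,\Phi)=\liminf_{\epsilon\to0}P_Z(T,\Phi,\epsilon)$; $P^*_\mu(T,\Phi,\epsilon)=\inf\{P_Z(T,\Phi,\epsilon):\mu(Z)=1\}$; $P^*_\mu(T,\Phi)=\liminf_{\epsilon\to0}P^*_\mu(T,\Phi,\epsilon)$. Capacity pressures: $\Lambda(Z,\Phi,N,\epsilon)=\inf\sum_ie^{\phi_N(x_i)}$ over covers $\{B_N(x_i,\epsilon)\}$ of $Z$; $\underline{CP}_Z(T,\Phi,\epsilon)$, $\overline{CP}_Z(T,\Phi,\epsilon)$ are the $\liminf$, $\limsup$ as $N\to\infty$ of $\frac1N\log\Lambda(Z,\Phi,N,\epsilon)$; $\underline{CP}^*_\mu(T,\Phi,\epsilon)=\lim_{\delta\to0}\inf\{\underline{CP}_Z(T,\Phi,\epsilon):\mu(Z)\ge1-\delta\}$, similarly $\overline{CP}^*_\mu(T,\Phi,\epsilon)$; $\underline{CP}^*_\mu(T,\Phi)=\liminf_{\epsilon\to0}\underline{CP}^*_\mu(T,\Phi,\epsilon)$,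 $\overline{CP}^*_\mu(T,\Phi)=\liminf_{\epsilon\to0}\overline{CP}^*_\mu(T,\Phi,\epsilon)$. *)

(* Defs.v *)
From HB Require Import structures.
From mathcomp Require Import all_boot all_order all_algebra.
From mathcomp Require Import all_classical all_reals all_analysis.
Set Implicit Arguments. Unset Strict Implicit. Unset Printing Implicit Defensive.
Import Order.TTheory GRing.Theory Num.Theory.
Local Open Scope classical_set_scope.
Local Open Scope ring_scope.

Section Defs.
Variables (R : realType) (X : pointedType) (d : X -> X -> R).

Definition is_metric : Prop :=
  [/\ forall x y, d x y = 0 <-> x = y,
      forall x y, d x y = d y x &
      forall x y z, d x z <= d x y + d y z].

Definition dopen (U : set X) : Prop :=
  forall x, U x -> exists2 e : R, 0 < e & forall y, d x y < e -> U y.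

Definition dcompact : Prop :=
  forall F : set (set X), (forall U, F U -> dopen U) ->
    (forall x, exists2 U, F U & U x) ->
    exists s : seq (set X), (forall U, U \in s -> F U) /\
      (forall x, exists2 U, U \in s & U x).

Definition dcontinuous_map (T : X -> X) : Prop :=
  forall x (e : R), 0 < e -> exists2 r : R, 0 < r &
    forall y, d x y < r -> d (T x) (T y) < e.

Definition dcontinuous_fun (f : X -> R) : Prop :=
  forall x (e : R), 0 < e -> exists2 r : R, 0 < r &
    forall y, d x y < r -> `|f x - f y| < e.

(** Supadditive potential: phi n for n >= 1 (phi 0 is irrelevant). *)
Definition supadditive_potential (T : X -> X) (phi : nat -> X -> R) : Prop :=
  (forall n, (1 <= n)%N -> dcontinuous_fun (phi n)) /\
  (forall n m x, (1 <= n)%N -> (1 <= m)%N ->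
     phi n x + phi m (iter n T x) <= phi (n + m)%N x).

Definition bowen_ball (T : X -> X) (n : nat) (x : X) (eps : R) : set X :=
  [set y | forall i, (i < n)%N -> d (iter i T x) (iter i T y) < eps].

End Defs.

Definition Borel (R : realType) (X : pointedType) (d : X -> X -> R) :=
  g_sigma_algebraType (dopen d).

Definition elog (R : realType) (x : \bar R) : \bar R :=
  match x with
  | +oo%E => +oo%E
  | r%:E => if 0 < r then (ln r)%:E else -oo%E
  | -oo%E => -oo%E
  end.

Definition elim0 (R : realType) (f : R -> \bar R) : \bar R := lim (f @ 0^'+).
Definition eliminf0 (R : realType) (f : R -> \bar R) : \bar R :=
  @limf_einf R R^o R f ((0 : R)^'+).

Section Dynamics.
Variables (R : realType) (X : pointedType) (d : X -> X -> R).
Local Notation B := (Borel d).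
Variables (T : B -> B) (mu : probability B R).

Definition T_invariant : Prop :=
  forall A : set B, measurable A -> mu (T @^-1` A) = mu A.

Definition T_ergodic : Prop :=
  forall A : set B, measurable A -> T @^-1` A = A -> mu A = 0%E \/ mu A = 1%E.

Definition meas_partition (xi : seq (set B)) : Prop :=
  [/\ forall A, A \in xi -> measurable A,
      forall i j, (i < j < size xi)%N -> nth set0 xi i `&` nth set0 xi j = set0 &
      forall x, exists2 A, A \in xi & A x].

Definition etafun (t : R) : R := if t == 0 then 0 else - (t * ln t).

Definition join_cell (xi : seq (set B)) (n : nat) (w : {ffun 'I_n -> 'I_(size xi)})
  : set B :=
  \bigcap_(i in [set i : 'I_n | True]) (iter i T @^-1` nth set0 xi (w i)).

Definition join_entropy (xi : seq (set B)) (n : nat) : R :=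
  \sum_(w : {ffun 'I_n -> 'I_(size xi)}) etafun (fine (mu (@join_cell xi n w))).

Definition part_entropy (xi : seq (set B)) : R :=
  limn ((fun n => join_entropy xi n / n%:R) : nat -> R^o).

Definition ms_entropy : \bar R :=
  ereal_sup [set (part_entropy xi)%:E | xi in meas_partition].

Variable phi : nat -> B -> R.

(** Phi_*(mu) = sup_n (1/n) int phi_n dmu  (= lim) *)
Definition Phi_star : \bar R :=
  ereal_sup [set ((n%:R)^-1)%:E * (\int[mu]_x (phi n x)%:E) | n in [set n | (1 <= n)%N]]%E.

Definition spanning (n : nat) (eps delta : R) (F : seq B) : Prop :=
  (mu (\bigcup_(x in [set x | x \in F]) bowen_ball d T n x eps) >= (1 - delta)%:E)%E.

Definition span_sum (n : nat) (eps delta : R) : \bar R :=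
  ereal_inf [set (\sum_(x <- F) expR (phi n x))%:E | F in spanning n eps delta].

Definition span_pressure_ed (eps delta : R) : \bar R :=
  limn_esup (fun n => ((n%:R)^-1)%:E * elog (span_sum n eps delta))%E.

Definition span_pressure_d (delta : R) : \bar R :=
  elim0 (fun eps => span_pressure_ed eps delta).

Definition span_pressure : \bar R := elim0 span_pressure_d.

(** a cover Gamma = {B_{n_i}(x_i,eps)} of Z is a countable set of pairs (x_i,n_i) *)
Definition cara_cover (Z : set B) (N : nat) (eps : R) (G : set (B * nat)) : Prop :=
  [/\ countable G, forall p, G p -> (N <= p.2)%N &
      Z `<=` \bigcup_(p in G) bowen_ball d T p.2 p.1 eps].

Definition caraM (Z : set B) (s : R) (N : nat) (eps : R) : \bar R :=
  ereal_inf [set (\esum_(p in G) (expR (- (s * p.2%:R) + phi p.2 p.1))%:E)%E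
            | G in cara_cover Z N eps].

Definition caram (Z : set B) (s eps : R) : \bar R :=
  limn (fun N => caraM Z s N eps).

Definition cara_PZ_eps (Z : set B) (eps : R) : \bar R :=
  ereal_inf [set s%:E | s in [set s | caram Z s eps = 0%E]].

Definition cara_PZ (Z : set B) : \bar R := eliminf0 (cara_PZ_eps Z).

Definition cara_pressure_eps (eps : R) : \bar R :=
  ereal_inf [set cara_PZ_eps Z eps | Z in [set Z | measurable Z /\ mu Z = 1%E]].

Definition cara_pressure : \bar R := eliminf0 cara_pressure_eps.

Definition cap_cover (Z : set B) (N : nat) (eps : R) (C : set B) : Prop :=
  countable C /\ Z `<=` \bigcup_(x in C) bowen_ball d T N x eps.

Definition capLambda (Z : set B) (N : nat) (eps : R) : \bar R :=
  ereal_inf [set (\esum_(x in C) (expR (phi N x))%:E)%E | C in cap_cover Z N eps].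

Definition lcap_Z (Z : set B) (eps : R) : \bar R :=
  limn_einf (fun N => ((N%:R)^-1)%:E * elog (capLambda Z N eps))%E.

Definition ucap_Z (Z : set B) (eps : R) : \bar R :=
  limn_esup (fun N => ((N%:R)^-1)%:E * elog (capLambda Z N eps))%E.

Definition lcap_pressure_eps (eps : R) : \bar R :=
  elim0 (fun delta => ereal_inf [set lcap_Z Z eps
          | Z in [set Z | measurable Z /\ (mu Z >= (1 - delta)%:E)%E]]).

Definition ucap_pressure_eps (eps : R) : \bar R :=
  elim0 (fun delta => ereal_inf [set ucap_Z Z eps
          | Z in [set Z | measurable Z /\ (mu Z >= (1 - delta)%:E)%E]]).

Definition lcap_pressure : \bar R := eliminf0 lcap_pressure_eps.
Definition ucap_pressure : \bar R := eliminf0 ucap_pressure_eps.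

End Dynamics.

(* Main.v *)
(** Write [S] for the sum of the entropy of [mu] and of [Phi_star].

    A superadditive sequence [psi_n] with [psi_n >= n c] for some large [n] at every
    point of a set of positive measure has mean at least [n (c - tau) - D]: by
    ergodicity, orbit segments are tiled greedily by blocks on which the inequality
    holds, up to short waiting times.  Applied to the set where [psi_n >= n c] infinitely
    often, this yields the upper half of Kingman's theorem.

    Upper bounds.  A sub-probability on words, built from the law of the [m]-blocks of a
    partition of small diameter, charges the [n]-itinerary of most points by at least
    [exp (- n (h + eta))], and [phi_n <= n (Phi_star + eta)] holds there for large [n];
    hence sets of measure close to 1 are covered by Bowen balls centred in them at cost
    [exp (n (S + 2 eta))].

    Lower bounds.  Every other pressure is reduced to the Caratheodory pressure of a set
    [Z] of positive measure.  From a cover of [Z] by balls [B_m(x, eps)] with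
    [sum exp (- s m + phi_m x) <= 1 / 2] one builds a sub-probability on words which
    either emits a uniform letter or picks a ball and emits a noisy copy of the itinerary
    of its centre.  The logarithm of its weight is superadditive along orbits, so the
    tiling principle bounds its mean from below, and Gibbs' inequality bounds the entropy
    of the partition by [s - Phi_star] up to small errors.  Only the continuity of a
    single [phi_k] enters, because [phi_m] dominates the Birkhoff sums of [phi_k / k] up
    to a constant. *)

Require Import Defs.
From HB Require Import structures.
From mathcomp Require Import all_boot all_order all_algebra.
From mathcomp Require Import all_classical all_reals all_analysis.
From mathcomp Require Import measurable_realfun.
From mathcomp Require Import ring lra zify.
Set Implicit Arguments. Unset Strict Implicit. Unset Printing Implicit Defensive.
Import Order.TTheory GRing.Theory Num.Theory numFieldNormedType.Exports.
Local Open Scope classical_set_scope.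
Local Open Scope ring_scope.

(** * Bounded measurable functions and invariant means *)

Section BoundedMeasurable.
Context {d : measure_display} {X : measurableType d} {R : realType}.
Variable mu : probability X R.
Implicit Types (f g : X -> R) (A B : set X).

(** Boundedness makes integrability under a probability automatic, so that [mean] is a real number
    and behaves linearly. *)
Definition bounded_measurable f :=
  measurable_fun setT f /\ exists C : R, forall x, `|f x| <= C.

Lemma bounded_measurableD f g : bounded_measurable f -> bounded_measurable g ->
  bounded_measurable (fun x => f x + g x).
Proof.
move=> [mf [C fC]] [mg [D gD]]; split; first exact: measurable_funD.
by exists (C + D) => x; rewrite (le_trans (ler_normD _ _))// lerD.
Qed.

Lemma bounded_measurable_cst c : bounded_measurable (fun=> c).
Proof. by split; [exact: measurable_cst|exists `|c|]. Qed.

Lemma bounded_measurableZ c f : bounded_measurable f ->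
  bounded_measurable (fun x => c * f x).
Proof.
move=> [mf [C fC]]; split; first exact: measurable_funM.
by exists (`|c| * C) => x; rewrite normrM ler_wpM2l.
Qed.

Lemma bounded_measurable_sum (I : Type) (s : seq I) (f : I -> X -> R) :
  (forall i, bounded_measurable (f i)) ->
  bounded_measurable (fun x => \sum_(i <- s) f i x).
Proof.
move=> bf; elim: s => [|i s IH].
  by under eq_fun do rewrite big_nil; exact: bounded_measurable_cst.
by under eq_fun do rewrite big_cons; exact: bounded_measurableD.
Qed.

Lemma bounded_measurable_indic A : measurable A ->
  bounded_measurable (\1_A : X -> R).
Proof.
move=> mA; split; first exact: measurable_indic.
by exists 1 => x; rewrite indicE; case: (_ \in _); rewrite ?normr0 ?normr1.
Qed.

Lemma bounded_measurable_integrable f : bounded_measurable f ->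
  mu.-integrable setT (EFin \o f).
Proof.
move=> [mf [C fC]]; apply: measurable_bounded_integrable => //.
  exact: fin_num_fun_lty.
by exists C; split; [exact: num_real|move=> y /ltW Cy x _ /=; exact: le_trans Cy].
Qed.

Definition mean f : R := \int[mu]_x f x.

Lemma meanE f : bounded_measurable f ->
  (\int[mu]_x (f x)%:E)%E = (mean f)%:E.
Proof.
move=> bf; rewrite /mean /Rintegral fineK//.
by apply: integrable_fin_num => //; exact: bounded_measurable_integrable.
Qed.

Lemma meanD f g : bounded_measurable f -> bounded_measurable g ->
  mean (fun x => f x + g x) = mean f + mean g.
Proof. by move=> bf bg; rewrite /mean RintegralD//; exact: bounded_measurable_integrable. Qed.

Lemma meanZ c f : bounded_measurable f -> mean (fun x => c * f x) = c * mean f.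
Proof. by move=> bf; rewrite /mean RintegralZl//; exact: bounded_measurable_integrable. Qed.

Lemma mean_cst c : mean (fun=> c) = c.
Proof. by rewrite /mean Rintegral_cst//= probability_setT mulr1. Qed.

Lemma mean_indic A : measurable A -> mean \1_A = fine (mu A).
Proof. by move=> mA; rewrite /mean /Rintegral integral_indic// setIT. Qed.

Lemma ler_mean f g : bounded_measurable f -> bounded_measurable g ->
  (forall x, f x <= g x) -> mean f <= mean g.
Proof. by move=> bf bg fg; rewrite /mean le_Rintegral//; exact: bounded_measurable_integrable. Qed.

Lemma mean_sum (I : Type) (s : seq I) (f : I -> X -> R) :
  (forall i, bounded_measurable (f i)) ->
  mean (fun x => \sum_(i <- s) f i x) = \sum_(i <- s) mean (f i).
Proof.
move=> bf; elim: s => [|i s IH].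
  by rewrite big_nil; under eq_fun do rewrite big_nil; rewrite mean_cst.
rewrite big_cons -IH -meanD//; first by congr mean; apply/funext => x; rewrite big_cons.
exact: bounded_measurable_sum.
Qed.

Definition pr A : R := fine (mu A).

Lemma prE A : measurable A -> mu A = (pr A)%:E.
Proof. by move=> mA; rewrite /pr fineK//; exact: fin_num_measure. Qed.

Lemma pr_ge0 A : 0 <= pr A.
Proof. by rewrite fine_ge0. Qed.

Lemma pr_setT : pr setT = 1.
Proof. by rewrite /pr probability_setT. Qed.

Lemma pr_set0 : pr set0 = 0.
Proof. by rewrite /pr measure0. Qed.

Lemma le_pr A B : measurable A -> measurable B -> A `<=` B -> pr A <= pr B.
Proof.
by move=> mA mB AB; rewrite -lee_fin -!prE//; apply: le_measure => //; rewrite inE.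
Qed.

Lemma pr_le1 A : measurable A -> pr A <= 1.
Proof. by move=> mA; rewrite -pr_setT le_pr. Qed.

Lemma prU A B : measurable A -> measurable B -> pr (A `|` B) <= pr A + pr B.
Proof.
move=> mA mB; rewrite -lee_fin EFinD -!prE//; last exact: measurableU.
exact: measureU2.
Qed.

Lemma prC A : measurable A -> pr (~` A) = 1 - pr A.
Proof.
move=> mA; apply: EFin_inj; rewrite -prE ?EFinB -?prE//; last exact: measurableC.
exact: probability_setC.
Qed.

Lemma prDI A B : measurable A -> measurable B -> pr A = pr (A `&` B) + pr (A `\` B).
Proof.
move=> mA mB; apply: EFin_inj.
rewrite EFinD -(prE (measurableI _ _ mA mB)) -(prE (measurableD mA mB)) -prE//.
by rewrite addeC -measureDI.
Qed.

Lemma pr_bigcup_nondecreasing (F : nat -> set X) (e : R) : 0 < e ->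
  (forall n, measurable (F n)) -> (forall m n, (m <= n)%N -> F m `<=` F n) ->
  exists n, pr (\bigcup_n F n) - e < pr (F n).
Proof.
move=> e0 mF ndF; have mU : measurable (\bigcup_n F n) by exact: bigcupT_measurable.
have ndF' : nondecreasing_seq F by move=> m n mn; apply/subsetPset; exact: ndF.
have cv : mu \o F @ \oo --> (pr (\bigcup_n F n))%:E.
  by rewrite -prE//; exact: nondecreasing_cvg_mu.
have : (fun n => pr (F n)) @ \oo --> pr (\bigcup_n F n).
  exact: (fine_cvg cv).
move=> /cvgrPdist_lt /(_ e e0) [n _ /(_ n (leqnn _))] H.
by exists n; move: H; rewrite ltr_distlC => /andP[].
Qed.

Lemma pr_bigcap_nonincreasing (F : nat -> set X) (e : R) : 0 < e ->
  (forall n, measurable (F n)) -> (forall m n, (m <= n)%N -> F n `<=` F m) ->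
  exists n, pr (F n) < pr (\bigcap_n F n) + e.
Proof.
move=> e0 mF niF.
have [n] := @pr_bigcup_nondecreasing (fun n => ~` F n) e e0
  (fun n => measurableC (mF n)) (fun m n mn => subsetC (niF _ _ mn)).
rewrite -setC_bigcap !prC//; last exact: bigcapT_measurable.
by exists n; lra.
Qed.

End BoundedMeasurable.

Lemma ler_sum_ord_cst (R : realType) n (F : 'I_n -> R) (c : R) :
  (forall i, F i <= c) -> \sum_i F i <= n%:R * c.
Proof.
by move=> Fc; rewrite (le_trans (ler_sum _ (fun i _ => Fc i)))// sumr_const card_ord mulr_natl.
Qed.

Lemma ger_sum_ord_cst (R : realType) n (F : 'I_n -> R) (c : R) :
  (forall i, c <= F i) -> n%:R * c <= \sum_i F i.
Proof.
by move=> Fc; rewrite (le_trans _ (ler_sum _ (fun i _ => Fc i)))// sumr_const card_ord mulr_natl.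
Qed.

(** * Superadditive sequences along orbits and visits to a set of positive measure *)

Section Superadditive.
Context {d : measure_display} {X : measurableType d} {R : realType}.
Variables (mu : probability X R) (T : X -> X).
Implicit Types (f g : X -> R) (A F : set X) (phi : nat -> X -> R).

Definition birkhoff_sum f n x : R := \sum_(j < n) f (iter j T x).

(** Time 0 is allowed, with value 0, so that inductions on orbit segments can start from the empty
    one. *)
Definition superadditive phi := (forall x, phi 0%N x = 0) /\
  forall n m x, phi n x + phi m (iter n T x) <= phi (n + m)%N x.

Lemma birkhoff_sumD f n m x :
  birkhoff_sum f (n + m) x = birkhoff_sum f n x + birkhoff_sum f m (iter n T x).
Proof.
rewrite /birkhoff_sum big_split_ord/=; congr (_ + _).
by apply: eq_bigr => i _; rewrite -iterD addnC.
Qed.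

Lemma birkhoff_sum1 f x : birkhoff_sum f 1 x = f x.
Proof. by rewrite /birkhoff_sum big_ord_recl big_ord0 addr0. Qed.

Lemma birkhoff_sum_superadditive f : superadditive (birkhoff_sum f).
Proof. by split=> [x|n m x]; rewrite ?birkhoff_sumD// /birkhoff_sum big_ord0. Qed.

Lemma superadditiveD phi psi : superadditive phi -> superadditive psi ->
  superadditive (fun n x => phi n x + psi n x).
Proof.
move=> [phi0 phiD] [psi0 psiD]; split=> [x|n m x]; first by rewrite phi0 psi0 addr0.
by rewrite addrACA lerD.
Qed.

Lemma ge_superadditive phi (C : R) : superadditive phi -> (forall x, - C <= phi 1%N x) ->
  forall n x, - (n%:R * C) <= phi n x.
Proof.
move=> [phi0 phiD] phi1; elim=> [|n IH] x; first by rewrite phi0 mul0r oppr0.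
have := phiD 1%N n x; rewrite add1n => /(le_trans _); apply.
by rewrite -nat1r mulrDl mul1r opprD lerD.
Qed.

(* The window sums [phi_n + ... + phi_(n+k-1)] telescope in [n]. *)
Lemma superadditive_ge_birkhoff phi (C D : R) (k : nat) : superadditive phi ->
  (forall x, - C <= phi 1%N x) -> (0 < k)%N -> (forall x, phi k x <= D) ->
  exists B : R, forall n x,
    birkhoff_sum (phi k) n x - B <= k%:R * phi n x.
Proof.
move=> sphi phi1 k0 phik.
have ge := ge_superadditive sphi phi1.
have [phi0 phiD] := sphi.
wlog C0 : C phi1 ge / 0 <= C.
  move=> /(_ `|C|); apply=> //.
    by move=> x; rewrite (le_trans _ (phi1 x))// lerN2 ler_norm.
  by move=> n x; rewrite (le_trans _ (ge n x))// lerN2 ler_wpM2l// ler_norm.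
wlog D0 : D phik / 0 <= D.
  by move=> /(_ `|D|); apply=> // x; rewrite (le_trans (phik x))// ler_norm.
pose b n x := \sum_(i < k) phi (n + i)%N x.
have bge n x : birkhoff_sum (phi k) n x - k%:R * (k%:R * C) <= b n x.
  elim: n => [|n IH].
    rewrite /birkhoff_sum big_ord0 sub0r -mulrN /b.
    apply: ger_sum_ord_cst => i; rewrite add0n (le_trans _ (ge i x))// lerN2 ler_wpM2r// ler_nat ltnW//.
  have -> : b n.+1 x = b n x + (phi (n + k)%N x - phi n x).
    rewrite /b; case: (k) k0 => // k' _; rewrite big_ord_recr/= [in RHS]big_ord_recl/= addn0.
    rewrite addSnnS; under [in RHS]eq_bigr do rewrite /bump/= add1n.
    under eq_bigr do rewrite addSnnS.
    lra.
  have := phiD n k x; rewrite -addn1 birkhoff_sumD birkhoff_sum1; lra.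
exists (k%:R * (k%:R * C) + k%:R * D + k%:R * (k%:R * C)) => n x.
have kn : k%:R * D + (k%:R * (k%:R * C)) >= 0 by rewrite addr_ge0// !mulr_ge0.
have [nk|kn'] := ltnP n k.
  have : birkhoff_sum (phi k) n x <= k%:R * D.
    by rewrite (le_trans (ler_sum_ord_cst (fun j => phik _)))// ler_wpM2r// ler_nat ltnW.
  have : - (k%:R * (k%:R * C)) <= k%:R * phi n x.
    rewrite -mulrN ler_wpM2l// (le_trans _ (ge n x))// lerN2 ler_wpM2r// ler_nat ltnW//.
  have : 0 <= k%:R * (k%:R * C) by rewrite !mulr_ge0.
  lra.
(* The window starting at [n - k] ends before [n]; going on from each of its times to [n] loses at
   most [k C], and the last [k] terms of the Birkhoff sum are worth at most [k D]. *)
have up i : (i < k)%N -> phi (n - k + i)%N x - k%:R * C <= phi n x.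
  move=> ik.
  have := phiD (n - k + i)%N (k - i)%N x.
  have -> : (n - k + i + (k - i) = n)%N by lia.
  have := ge (k - i)%N (iter (n - k + i) T x).
  have : (k - i)%:R * C <= k%:R * C by rewrite ler_wpM2r// ler_nat leq_subr.
  lra.
have : b (n - k)%N x <= k%:R * (phi n x + k%:R * C).
  apply: ler_sum_ord_cst => i; by have := up i (ltn_ord i); lra.
have := bge (n - k)%N x.
have : birkhoff_sum (phi k) k (iter (n - k) T x) <= k%:R * D.
  exact: ler_sum_ord_cst.
rewrite -[in birkhoff_sum _ n x](subnK kn') birkhoff_sumD; lra.
Qed.

Hypothesis mT : measurable_fun setT T.
Hypothesis Tinv : forall A, measurable A -> mu (T @^-1` A) = mu A.

Lemma measurable_iter n : measurable_fun setT (iter n T).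
Proof.
elim: n => [|n IH]; first exact: measurable_id.
exact: (measurableT_comp mT IH).
Qed.

Lemma measurable_preimage_iter n A : measurable A -> measurable (iter n T @^-1` A).
Proof. by move=> mA; rewrite -[X in measurable X]setTI; exact: measurable_iter. Qed.

Lemma pr_preimage_iter n A : measurable A -> pr mu (iter n T @^-1` A) = pr mu A.
Proof.
move=> mA; elim: n => [//|n IH].
rewrite -IH /pr -[in RHS]Tinv; last exact: measurable_preimage_iter.
by congr (fine (mu _)); apply/seteqP; split => x /=; rewrite -iterS iterSr.
Qed.

Lemma bounded_measurable_iter n f : bounded_measurable f ->
  bounded_measurable (fun x => f (iter n T x)).
Proof.
move=> [mf [C fC]]; split; last by exists C.
exact: (measurableT_comp mf (measurable_iter n)).
Qed.

Lemma bounded_measurable_birkhoff f n : bounded_measurable f ->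
  bounded_measurable (birkhoff_sum f n).
Proof. by move=> bf; apply: bounded_measurable_sum => i; exact: bounded_measurable_iter. Qed.

Lemma mean_comp f : bounded_measurable f -> mean mu (f \o T) = mean mu f.
Proof.
move=> bf; have bfT := bounded_measurable_iter 1 bf.
rewrite /mean /Rintegral; congr fine.
have := @integral_pushforward _ _ _ _ R T mT mu setT (EFin \o f).
rewrite preimage_setT => <- //; first last.
- exact: (bounded_measurable_integrable mu bfT).
- by apply/measurable_EFinP; case: bf.
apply: eq_measure_integral => A mA _; exact: Tinv.
Qed.

Lemma mean_iter n f : bounded_measurable f -> mean mu (fun x => f (iter n T x)) = mean mu f.
Proof.
move=> bf; elim: n => [//|n <-].
rewrite -[RHS](mean_comp (bounded_measurable_iter n bf)).
by congr mean; apply/funext => x /=; rewrite -iterS iterSr.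
Qed.

Lemma mean_birkhoff f n : bounded_measurable f ->
  mean mu (birkhoff_sum f n) = n%:R * mean mu f.
Proof.
move=> bf; rewrite mean_sum; last by move=> i; exact: bounded_measurable_iter.
rewrite (eq_bigr (fun=> mean mu f)); last by move=> i _; rewrite mean_iter.
by rewrite sumr_const card_ord mulr_natl.
Qed.

Hypothesis Terg : forall A, measurable A -> T @^-1` A = A -> mu A = 0%E \/ mu A = 1%E.

Definition hits A (K : nat) : set X := [set x | exists2 k, (k <= K)%N & A (iter k T x)].

Lemma measurable_hits A K : measurable A -> measurable (hits A K).
Proof.
move=> mA; have -> : hits A K = \bigcup_(k in [set k | (k <= K)%N]) (iter k T @^-1` A).
  by apply/seteqP; split => x [k kK Ak]; exists k.
by apply: bigcup_measurable => k _; exact: measurable_preimage_iter.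
Qed.

Lemma pr_hits_le A K : measurable A -> pr mu (hits A K) <= K.+1%:R * pr mu A.
Proof.
move=> mA; elim: K => [|K IH].
  rewrite mul1r; apply: le_pr => //; first exact: measurable_hits.
  by move=> x [[]].
have : hits A K.+1 `<=` hits A K `|` iter K.+1 T @^-1` A.
  move=> x [k]; rewrite leq_eqVlt => /predU1P[->|kK] Ak; [by right|left].
  by exists k.
have m1 := measurable_hits K mA; have m2 := measurable_preimage_iter K.+1 mA.
move=> /(le_pr mu (measurable_hits K.+1 mA) (measurableU _ _ m1 m2)) /le_trans; apply.
rewrite (le_trans (prU mu m1 m2))// pr_preimage_iter//.
by rewrite [in leRHS]mulrSr mulrDl mul1r lerD2r.
Qed.

(** The points that ever visit [A] form a set [E] with [T^-1 E] contained in [E]. The intersection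
    of its iterated preimages is invariant and has the measure of [E], so ergodicity makes it full,
    and [E] is the increasing union of the sets [hits A K]. *)
Lemma ergodic_hits A (e : R) : measurable A -> 0 < pr mu A -> 0 < e ->
  exists K, 1 - e < pr mu (hits A K).
Proof.
move=> mA A0 e0; pose E := \bigcup_K hits A K.
have mE : measurable E by apply: bigcupT_measurable => K; exact: measurable_hits.
have TE : T @^-1` E `<=` E.
  move=> x [K _ [k kK Ak]]; exists K.+1 => //; exists k.+1 => //.
  by rewrite iterSr.
pose B := \bigcap_n iter n T @^-1` E.
have mB : measurable B by apply: bigcapT_measurable => n; exact: measurable_preimage_iter.
have TB : T @^-1` B = B.
  apply/seteqP; split => x Bx n _ /=.
    by case: n => [|n]; [exact: TE (Bx 0%N I)|rewrite iterSr; exact: Bx].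
  by rewrite -iterSr; exact: Bx.
have hT m n : (m <= n)%N -> iter n T @^-1` E `<=` iter m T @^-1` E.
  move=> mn x /=; rewrite -(subnK mn); elim: (n - m)%N => [//|k IH].
  by rewrite addSn iterS => /TE /IH.
have EB : pr mu E <= pr mu B.
  apply/ler_addgt0Pr => r r0.
  have [n] := pr_bigcap_nonincreasing mu r0 (fun n => measurable_preimage_iter n mE) hT.
  by rewrite pr_preimage_iter// => /ltW.
have AE : A `<=` E by move=> x Ax; exists 0%N => //; exists 0%N.
have hm m n : (m <= n)%N -> hits A m `<=` hits A n.
  by move=> mn x [k km Ak]; exists k => //; exact: leq_trans mn.
have [n Hn] := pr_bigcup_nondecreasing mu e0 (fun n => measurable_hits n mA) hm.
exists n; apply: le_lt_trans Hn; rewrite lerD2r.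
have BE : B `<=` E by move=> x /(_ 0%N I).
rewrite (le_trans _ (le_pr mu mB mE BE))//.
have := le_pr mu mA mE AE; case: (Terg mB TB); rewrite prE// => -[]; lra.
Qed.

End Superadditive.

(** * Superadditive sequences over an ergodic map *)

Section Tiling.
Context {d : measure_display} {X : measurableType d} {R : realType}.
Variables (mu : probability X R) (T : X -> X).
Hypothesis mT : measurable_fun setT T.
Hypothesis Tinv : forall A, measurable A -> mu (T @^-1` A) = mu A.
Hypothesis Terg : forall A, measurable A -> T @^-1` A = A -> mu A = 0%E \/ mu A = 1%E.

(* Greedy tiling: an orbit segment is cut into blocks starting at visits to [F'], where
   [phi] is large; the waiting times, at most [K], are short compared with the blocks,
   and the remaining times are those spent outside [hits T F' K]. *)
Lemma superadditive_ge_tiling (phi : nat -> X -> R) (F' : set X) (c C t : R) (K N0 M : nat) :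
  superadditive T phi -> (forall x, - C <= phi 1%N x) -> 0 <= C -> 0 <= t ->
  (0 < N0)%N -> K%:R * (C + `|c|) <= N0%:R * t ->
  (forall x, F' x -> exists2 n, (N0 <= n <= M)%N & n%:R * c <= phi n x) ->
  forall n x, birkhoff_sum T (fun y => c - t - (C + `|c|) * \1_(~` hits T F' K) y) n x
    - (K + M)%:R * (C + `|c|) <= phi n x.
Proof.
move=> sphi phi1 C0 t0 N00 KN0 hF'.
have ge := ge_superadditive sphi phi1; have [phi0 phiD] := sphi.
set C' := C + `|c|; have C'0 : 0 <= C' by rewrite addr_ge0.
have cC : c <= C' by rewrite (le_trans (ler_norm c))// lerDr.
have cC' : - C' <= - `|c| by rewrite lerN2 lerDr.
have CC' : c - C' <= - C by have := ler_norm c; rewrite /C'; lra.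
set g := fun y => _; have gle y : g y <= c - t.
  by rewrite /g gerBl mulr_ge0// indicE.
set D := _ * C'; have D0 : 0 <= D by rewrite mulr_ge0.
elim/ltn_ind => -[_ x|n IH x]; first by rewrite /birkhoff_sum big_ord0 phi0 sub0r oppr_le0.
(* If no visit to [F'] is near, a single step is made, and the indicator term of [g] pays for it. *)
have [[k kK Fk]|Nh] := pselect (hits T F' K x); last first.
  have := phiD 1%N n x; rewrite add1n => /(le_trans _); apply.
  have gx : g x = c - t - C' by rewrite /g indicE mem_set// mulr1.
  rewrite -add1n birkhoff_sumD birkhoff_sum1 gx.
  by have := IH n (ltnSn n) (iter 1 T x); have := phi1 x; lra.
have [m /andP[N0m mM] phim] := hF' _ Fk.
have gb y i : birkhoff_sum T g i y <= i%:R * (c - t) by exact: ler_sum_ord_cst.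
(* If the block overruns the end, the segment is at most [K + M] long; the boundary term [D] pays
   for it. *)
have [nkm|kmn] := ltnP n.+1 (k + m)%N.
  have := ge n.+1 x; have := gb x n.+1.
  have : n.+1%:R * (c - t) - D <= - (n.+1%:R * C).
    have : n.+1%:R * C' <= D.
      by rewrite ler_wpM2r// ler_nat (leq_trans (ltnW nkm))// leq_add.
    have : n.+1%:R * (c - C' - t) <= n.+1%:R * - C by rewrite ler_wpM2l//; lra.
    lra.
  lra.
(* Waiting [k <= K] times loses at most [K C'], and the block gains [m t >= N0 t >= K C'] by being
   compared with [c - t] instead of [c]. *)
have key : birkhoff_sum T g (k + m) x <= phi (k + m)%N x.
  apply: le_trans (gb _ _) _; apply: le_trans (phiD k m x).
  have := ge k x; rewrite natrD.
  have : m%:R * t >= N0%:R * t by rewrite ler_wpM2r// ler_nat.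
  have : k%:R * C' <= K%:R * C' by rewrite ler_wpM2r// ler_nat.
  have : k%:R * (c - C') <= k%:R * - C by rewrite ler_wpM2l.
  have : 0 <= k%:R * t by rewrite mulr_ge0.
  rewrite -/C' in KN0; lra.
have -> : (n.+1 = (k + m) + (n.+1 - (k + m)))%N by rewrite subnKC.
rewrite birkhoff_sumD; apply: le_trans (phiD _ _ _).
have lt : (n.+1 - (k + m) < n.+1)%N.
  by rewrite ltn_subrL /= andbT addn_gt0 (leq_trans N00 N0m) orbT.
by have := IH _ lt (iter (k + m) T x); lra.
Qed.

(** The tiling inequality, integrated. [N0] and [rho] are chosen before [phi] and [F'], because
    later [phi] is built from covers by balls of length at least [N0], and [F'] is what a finite
    part of such a cover retains of [F]. *)
Lemma ergodic_superadditive_mean_ge (F : set X) (c C tau : R) :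
  measurable F -> 0 < pr mu F -> 0 <= C -> 0 < tau ->
  exists N0 : nat, exists2 rho : R, 0 < rho &
    forall (phi : nat -> X -> R) (F' : set X) (M : nat),
      superadditive T phi -> (forall n, bounded_measurable (phi n)) ->
      (forall x, - C <= phi 1%N x) ->
      measurable F' -> F' `<=` F -> pr mu F - rho <= pr mu F' ->
      (forall x, F' x -> exists2 n, (N0 <= n <= M)%N & n%:R * c <= phi n x) ->
      exists D : R, forall n, n%:R * (c - tau) - D <= mean mu (phi n).
Proof.
move=> mF F0 C0 tau0; set C' := C + `|c|; have C'0 : 0 <= C' by rewrite addr_ge0.
(* With this [del] the times far from [F'] lose at most [tau / 2] per step; the tiling with
   [t = tau / 2] loses the other half. *)
pose del := tau / (2 * (C' + 1)).
have del0 : 0 < del by rewrite divr_gt0// mulr_gt0//; lra.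
have [K HK] := ergodic_hits mT Tinv Terg mF F0 (divr_gt0 del0 (ltr0Sn _ 1)).
pose N0 := (Num.truncn (K%:R * C' / (tau / 2))).+1.
have N0P : K%:R * C' <= N0%:R * (tau / 2).
  by rewrite -ler_pdivrMr ?divr_gt0// ltW// truncnS_gt.
(* Visits to [F] that miss [F'] land in a set of measure at most [rho]; within [K] steps this
   concerns measure at most [(K + 1) rho = del / 2]. *)
have [rho rho0 rhoE] : exists2 rho : R, 0 < rho & K.+1%:R * rho = del / 2.
  exists (del / (2 * K.+1%:R)); first by rewrite divr_gt0// mulr_gt0.
  by field; rewrite nat1r pnatr_eq0.
exists N0, rho => //.
move=> phi F' M sphi bphi phi1 mF' F'F prF' hF'.
exists ((K + M)%:R * C') => n.
have ptw := superadditive_ge_tiling sphi phi1 C0 (ltW (divr_gt0 tau0 (ltr0Sn _ 1))) (ltn0Sn _) N0P hF'.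
have mh : measurable (hits T F' K) by exact: (measurable_hits mT).
set g := (fun y => _) in ptw.
have bI : bounded_measurable (\1_(~` hits T F' K) : X -> R).
  by apply: bounded_measurable_indic; exact: measurableC.
have bg : bounded_measurable g.
  rewrite (_ : g = fun y => (c - tau / 2) + (- C') * \1_(~` hits T F' K) y); last first.
    by apply/funext => y; rewrite /g mulNr.
  by apply: bounded_measurableD; [exact: bounded_measurable_cst|exact: bounded_measurableZ].
have mg : mean mu g = c - tau / 2 - C' * pr mu (~` hits T F' K).
  rewrite /g meanD; last 2 first.
  - exact: bounded_measurable_cst.
  - by under eq_fun do rewrite -mulNr; exact: bounded_measurableZ.
  rewrite mean_cst; congr (_ + _); under eq_fun do rewrite -mulNr.
  by rewrite meanZ// mean_indic ?mulNr//; exact: measurableC.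
have prb : pr mu (~` hits T F' K) <= del.
  have mD : measurable (F `\` F') by exact: measurableD.
  have sub : hits T F K `<=` hits T F' K `|` hits T (F `\` F') K.
    move=> x [k kK Fk]; have [F'k|F'k] := pselect (F' (iter k T x)); [left|right].
      by exists k.
    by exists k.
  have m3 : measurable (hits T (F `\` F') K) by exact: (measurable_hits mT).
  have := le_pr mu (measurable_hits mT K mF) (measurableU _ _ mh m3) sub.
  have := prU mu mh m3; have := pr_hits_le mT Tinv K mD.
  have := prDI mu mF mF'; rewrite (setIidr F'F) => e.
  have : K.+1%:R * pr mu (F `\` F') <= del / 2.
    by rewrite -rhoE ler_wpM2l//; lra.
  rewrite prC//; lra.
have : C' * pr mu (~` hits T F' K) <= tau / 2.
  have -> : tau / 2 = (C' + 1) * del by rewrite /del; field; rewrite gt_eqF//; lra.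
  by apply: ler_pM => //; [exact: pr_ge0|lra].
have bb := bounded_measurable_birkhoff mT n bg.
have : mean mu (fun x => birkhoff_sum T g n x + (- ((K + M)%:R * C'))) <= mean mu (phi n).
  apply: ler_mean => //; apply: bounded_measurableD => //; exact: bounded_measurable_cst.
rewrite meanD//; last exact: bounded_measurable_cst.
rewrite mean_cst mean_birkhoff// mg => h1 h2.
have : n%:R * (c - tau) <= n%:R * (c - tau / 2 - C' * pr mu (~` hits T F' K)).
  by rewrite ler_wpM2l//; lra.
lra.
Qed.

(* The upper half of Kingman's subadditive ergodic theorem, for [- phi]. *)
Lemma superadditive_eventually_lt (phi : nat -> X -> R) (b eta del : R) :
  superadditive T phi -> (forall n, bounded_measurable (phi n)) ->
  (forall n, mean mu (phi n) <= n%:R * b) -> 0 < eta -> 0 < del ->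
  exists2 Z, measurable Z /\ 1 - del < pr mu Z &
    exists N : nat, forall x n, Z x -> (N <= n)%N -> phi n x < n%:R * (b + eta).
Proof.
move=> sphi bphi hb eta0 del0.
pose G n := [set x | n%:R * (b + eta) <= phi n x].
have mG n : measurable (G n).
  have [mphi _] := bphi n.
  rewrite (_ : G n = setT `&` phi n @^-1` `[n%:R * (b + eta), +oo[); last first.
    by rewrite setTI; apply/seteqP; split => x; rewrite /G /= in_itv/= andbT.
  exact: mphi.
pose U N M := \bigcup_(n in [set n | (N <= n <= M)%N]) G n.
pose V N := \bigcup_(n in [set n | (N <= n)%N]) G n.
pose F := \bigcap_N V N.
have mU N M : measurable (U N M) by apply: bigcup_measurable.
have mV N : measurable (V N) by apply: bigcup_measurable.
have mF : measurable F by apply: bigcapT_measurable.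
have Vmono m n : (m <= n)%N -> V n `<=` V m.
  by move=> mn x [k /= nk Gk]; exists k => //=; exact: leq_trans nk.
(* On [F] the bound fails infinitely often. If [F] had positive measure, the means of [phi n] would
   grow at rate at least [b + eta / 2], against the hypothesis on them. *)
have F0 : pr mu F = 0.
  apply/eqP; rewrite eq_le pr_ge0 andbT leNgt; apply/negP => F0.
  have [C phi1] : exists C : R, forall x, `|phi 1%N x| <= C by case: (bphi 1%N).
  have C0 : 0 <= C by rewrite (le_trans _ (phi1 point)).
  have [N0 [rho rho0 H]] :=
    ergodic_superadditive_mean_ge (b + eta) mF F0 C0 (divr_gt0 eta0 (ltr0Sn _ 1)).
  have mono m n : (m <= n)%N -> F `&` U N0 m `<=` F `&` U N0 n.
    move=> mn x [Fx [k /= /andP[N0k km] Gk]]; split => //; exists k => //=.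
    by rewrite N0k (leq_trans km).
  have [M HM] := pr_bigcup_nondecreasing mu rho0 (fun n => measurableI _ _ mF (mU N0 n)) mono.
  have FE : F `<=` \bigcup_n (F `&` U N0 n).
    move=> x Fx; have [n /= N0n Gn] := Fx N0 I.
    by exists n => //; split => //; exists n => //=; rewrite N0n leqnn.
  have mB : measurable (\bigcup_n (F `&` U N0 n)).
    by apply: bigcupT_measurable => n; exact: measurableI.
  have := le_pr mu mF mB FE => FB.
  have [D HD] := H phi (F `&` U N0 M) M sphi bphi
    (fun x => lerNnormlW (phi1 x)) (measurableI _ _ mF (mU N0 M)) (@subIsetl _ _ _)
    (ltW (le_lt_trans (lerB FB (lexx _)) HM))
    (fun x Fx => let: ex_intro2 n a b := Fx.2 in ex_intro2 _ _ n a b).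
  pose n := (Num.truncn (D / (eta / 2))).+1.
  have : D < n%:R * (eta / 2) by rewrite -ltr_pdivrMr ?divr_gt0// truncnS_gt.
  have := HD n; have := hb n; lra.
have [N HN] := pr_bigcap_nonincreasing mu del0 mV Vmono.
exists (~` V N); first by split; [exact: measurableC|rewrite prC//; rewrite -/F F0 in HN; lra].
exists N => x n Vx Nn; rewrite ltNge; apply/negP => h; apply: Vx.
by exists n.
Qed.

End Tiling.

(** * Words, parsings and entropy *)

Section Words.
Context {A : finType} {R : realType}.
Implicit Types (u v w : seq A).

Fixpoint words (n : nat) : seq (seq A) :=
  if n is n'.+1 then [seq a :: w | a <- enum A, w <- words n'] else [:: [::]].

Lemma mem_words n w : (w \in words n) = (size w == n).
Proof.
elim: n w => [|n IH] [|a w] //=.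
  by apply/negbTE/negP => /allpairsP[[b v] /= [_ _]].
rewrite eqSS -IH; apply/allpairsP/idP => [[[b v] /= [_ vn [_ ->]]]//|wn].
by exists (a, w); rewrite mem_enum.
Qed.

Lemma uniq_words n : uniq (words n).
Proof.
elim: n => [//|n IH] /=; apply: allpairs_uniq => //; first exact: enum_uniq.
by move=> [a u] [b v] _ _ /= [-> ->].
Qed.

Arguments words : simpl never.

Lemma sum_wordsS n (F : seq A -> R) : \sum_(w <- words n.+1) F w =
  \sum_(a : A) \sum_(w <- words n) F (a :: w).
Proof.
by rewrite -[words n.+1]/([seq a :: w | a <- enum A, w <- words n]) big_allpairs_dep/= big_enum.
Qed.

Lemma sum_wordsD n m (F : seq A -> R) : \sum_(w <- words (n + m)) F w =
  \sum_(u <- words n) \sum_(v <- words m) F (u ++ v).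
Proof.
elim: n F => [|n IH] F; first by rewrite big_seq1.
rewrite addSn !sum_wordsS; apply: eq_bigr => a _.
by rewrite (IH (fun w => F (a :: w))).
Qed.

Lemma sum_words1 (F : seq A -> R) : \sum_(w <- words 1) F w = \sum_(a : A) F [:: a].
Proof.
by rewrite sum_wordsS; apply: eq_bigr => a _; rewrite big_seq1.
Qed.

Section Parse.
Variable r : seq A -> R.

(** The recursive call is on [drop l.+1 w], which is not structurally smaller; the fuel [k] bounds
    the depth, and any [k >= size w] gives the same value. *)
Fixpoint parse_fuel (k : nat) w : R :=
  if k is k'.+1 then
    if w is [::] then 1
    else \sum_(l < size w) r (take l.+1 w) * parse_fuel k' (drop l.+1 w)
  else 1.

(* Total weight of all ways to cut [w] into nonempty words, each weighted by [r]:
   a supermultiplicative sub-probability on the words of any given length. *)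
Definition parse_weight w := parse_fuel (size w) w.

Lemma parse_fuelE k w : (size w <= k)%N -> parse_fuel k w = parse_weight w.
Proof.
rewrite /parse_weight; elim/ltn_ind: k w => -[|k] IH [|a w] //=; rewrite ltnS => wk.
apply: eq_bigr => l _; congr (_ * _).
have sw : (size (drop l w) <= size w)%N by rewrite size_drop leq_subr.
by rewrite IH// ?(leq_trans sw)// [RHS]IH//.
Qed.

Lemma parse_weight_nil : parse_weight [::] = 1. Proof. by []. Qed.

Lemma parse_weightE w : w != [::] ->
  parse_weight w = \sum_(l < size w) r (take l.+1 w) * parse_weight (drop l.+1 w).
Proof.
case: w => // a w _.
rewrite -[LHS]/(\sum_(l < (size w).+1)
  r (take l.+1 (a :: w)) * parse_fuel (size w) (drop l.+1 (a :: w))).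
by apply: eq_bigr => l _; rewrite parse_fuelE//= size_drop leq_subr.
Qed.

Hypothesis r0 : forall w, 0 <= r w.

Lemma parse_weight_ge0 w : 0 <= parse_weight w.
Proof.
have [n] := ubnP (size w); elim: n w => // n IH [//|a w] /= wn.
rewrite parse_weightE//; apply: sumr_ge0 => l _; rewrite mulr_ge0// IH//=.
by rewrite size_drop (leq_ltn_trans (leq_subr _ _)).
Qed.

Lemma parse_weight_ge w : w != [::] -> r w <= parse_weight w.
Proof.
case: w => // a w _; rewrite parse_weightE//= big_ord_recr/=.
rewrite take_size drop_size parse_weight_nil mulr1 lerDr.
by apply: sumr_ge0 => l _; rewrite mulr_ge0// parse_weight_ge0.
Qed.

(** Cuts of [u] and of [v] combine into the cuts of [u ++ v] that pass through the junction; the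
    other cuts contribute nonnegative terms. *)
Lemma parse_weight_cat u v : parse_weight u * parse_weight v <= parse_weight (u ++ v).
Proof.
have [n] := ubnP (size u); elim: n u => // n IH [|a u] un; first by rewrite mul1r.
rewrite parse_weightE// [leRHS]parse_weightE// mulr_suml size_cat big_split_ord/=.
rewrite ler_wpDr//; first by apply: sumr_ge0 => l _; rewrite mulr_ge0// parse_weight_ge0.
apply: ler_sum => -[l/= lu] _.
rewrite take_cat drop_cat; rewrite ltnS in lu.
rewrite leq_eqVlt in lu; case/predU1P: lu => [->|lu].
  rewrite ltnn subnn !take0 !drop0 !cats0 take_size drop_size.
  by rewrite parse_weight_nil mulr1.
rewrite lu -mulrA ler_wpM2l// IH// size_drop.
by rewrite /= ltnS in un; rewrite (leq_ltn_trans _ un)// leq_subr.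
Qed.

(** Renewal argument: the first word is split off, the rest has total weight at most 1 by induction,
    and the first words of all lengths together have weight at most 1. *)
Lemma sum_parse_weight_le1 n :
  (forall k, \sum_(l < k) \sum_(u <- words l.+1) r u <= 1) ->
  \sum_(w <- words n) parse_weight w <= 1.
Proof.
move=> r1; elim/ltn_ind: n => -[_|n IH]; first by rewrite big_seq1.
rewrite big_seq (eq_bigr (fun w =>
   \sum_(l < n.+1) r (take l.+1 w) * parse_weight (drop l.+1 w))); last first.
  by move=> [|a w]; rewrite mem_words // => /eqP wn; rewrite parse_weightE// wn.
rewrite -big_seq exchange_big; apply: le_trans (r1 n.+1); apply: ler_sum => l _.
have E : (n.+1 = l.+1 + (n - l))%N by have := ltn_ord l; lia.
rewrite [X in words X]E sum_wordsD big_seq [leRHS]big_seq; apply: ler_sum => u.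
rewrite mem_words => /eqP ul.
under eq_bigr do rewrite take_size_cat// drop_size_cat//.
by rewrite -mulr_sumr ler_piMr// IH//; lia.
Qed.

End Parse.
End Words.
Arguments words : simpl never.

(** * Itineraries, cylinders and the entropy of words *)

Section Names.
Context {d : measure_display} {X : measurableType d} {R : realType} {A : finType}.
Variables (mu : probability X R) (T : X -> X) (code : X -> A).
Hypothesis mT : measurable_fun setT T.
Hypothesis Tinv : forall B, measurable B -> mu (T @^-1` B) = mu B.
Hypothesis mcode : forall a, measurable (code @^-1` [set a]).

Fixpoint itinerary (n : nat) x : seq A :=
  if n is n'.+1 then code x :: itinerary n' (T x) else [::].

Lemma size_itinerary n x : size (itinerary n x) = n.
Proof. by elim: n x => //= n IH x; rewrite IH. Qed.

Lemma itineraryD n m x :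
  itinerary (n + m) x = itinerary n x ++ itinerary m (iter n T x).
Proof. by elim: n x => //= n IH x; rewrite IH -iterSr. Qed.

Lemma nth_itinerary a0 n x i : (i < n)%N -> nth a0 (itinerary n x) i = code (iter i T x).
Proof. by elim: n x i => // n IH x [|i] //= ni; rewrite IH// -iterSr. Qed.

Definition cylinder w : set X := [set x | itinerary (size w) x = w].

Lemma measurable_cylinder w : measurable (cylinder w).
Proof.
elim: w => [|a w IH]; first by rewrite (_ : cylinder _ = setT)//; apply/seteqP; split.
rewrite (_ : cylinder _ = code @^-1` [set a] `&` T @^-1` cylinder w).
  by apply: measurableI => //; rewrite -[X in measurable X]setTI; exact: mT.
by apply/seteqP; split => x; rewrite /cylinder/=; [move=> [? ?]|move=> [-> ->]].
Qed.

Definition cyl_pr w : R := pr mu (cylinder w).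

Lemma cyl_pr_ge0 w : 0 <= cyl_pr w. Proof. exact: pr_ge0. Qed.

Lemma itinerary_sum n (F : seq A -> R) x :
  F (itinerary n x) = \sum_(w <- words n) F w * \1_(cylinder w) x.
Proof.
have iw : itinerary n x \in words n by rewrite mem_words size_itinerary.
rewrite (bigD1_seq _ iw (uniq_words n))/= big_seq_cond big1 ?addr0.
  by rewrite indicE mem_set ?mulr1//= /cylinder/= size_itinerary.
move=> w /andP[wn wi]; rewrite indicE memNset ?mulr0// /cylinder/= => ww.
by move: wn; rewrite mem_words => /eqP wn; rewrite -ww wn eqxx in wi.
Qed.

Lemma bounded_measurable_itinerary n (F : seq A -> R) :
  bounded_measurable (fun x => F (itinerary n x)).
Proof.
under eq_fun do rewrite itinerary_sum.
apply: bounded_measurable_sum => w; apply: bounded_measurableZ.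
exact/bounded_measurable_indic/measurable_cylinder.
Qed.

Lemma mean_itinerary n (F : seq A -> R) :
  mean mu (fun x => F (itinerary n x)) = \sum_(w <- words n) F w * cyl_pr w.
Proof.
under eq_fun do rewrite itinerary_sum.
rewrite mean_sum; last first.
  move=> w; apply: bounded_measurableZ.
  exact/bounded_measurable_indic/measurable_cylinder.
apply: eq_bigr => w _; rewrite meanZ ?mean_indic//; first exact: measurable_cylinder.
exact/bounded_measurable_indic/measurable_cylinder.
Qed.

Lemma sum_cyl_pr n : \sum_(w <- words n) cyl_pr w = 1.
Proof.
rewrite -[RHS](mean_cst mu 1) (mean_itinerary n (fun=> 1)).
by apply: eq_bigr => w _; rewrite mul1r.
Qed.

Lemma cyl_pr_cat_le u v : cyl_pr (u ++ v) <= cyl_pr u /\ cyl_pr (u ++ v) <= cyl_pr v.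
Proof.
have sub : cylinder (u ++ v) `<=` cylinder u `&` iter (size u) T @^-1` cylinder v.
  move=> x; rewrite /cylinder/= size_cat itineraryD => /eqP.
  by rewrite eqseq_cat ?size_itinerary// => /andP[/eqP ? /eqP ?].
have m1 := measurable_cylinder (u ++ v).
have m3 := measurable_preimage_iter mT (size u) (measurable_cylinder v).
split.
  apply: le_pr => //; first exact: measurable_cylinder.
  by apply: (subset_trans sub) => x [].
rewrite /cyl_pr -(pr_preimage_iter mT Tinv (size u) (measurable_cylinder v)).
by apply: le_pr => //; apply: (subset_trans sub) => x [].
Qed.

Definition word_entropy n : R := \sum_(w <- words n) etafun (cyl_pr w).

Lemma etafunE (t : R) : etafun t = - (t * ln t).
Proof. by rewrite /etafun; case: eqP => // ->; rewrite mul0r oppr0. Qed.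

(** Gibbs' inequality, from [ln t <= t - 1] at [t = V w / cyl_pr w]; words of measure zero
    contribute nothing on the left. *)
Lemma word_entropy_gibbs n (V : seq A -> R) : (forall w, 0 <= V w) ->
  (forall w, size w = n -> 0 < cyl_pr w -> 0 < V w) -> \sum_(w <- words n) V w <= 1 ->
  word_entropy n <= \sum_(w <- words n) - ln (V w) * cyl_pr w.
Proof.
move=> V0 Vp V1; rewrite -subr_le0 -sumrB.
apply: (@le_trans _ _ (\sum_(w <- words n) (V w - cyl_pr w))); last first.
  by rewrite sumrB sum_cyl_pr subr_le0.
rewrite big_seq [leRHS]big_seq; apply: ler_sum => w; rewrite mem_words => /eqP wn.
rewrite etafunE mulNr opprK.
have [p0|p0] := ltP 0 (cyl_pr w); last first.
  have -> : cyl_pr w = 0 by apply/eqP; rewrite eq_le p0 cyl_pr_ge0.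
  by rewrite mul0r mulr0 oppr0 !addr0.
have v0 := Vp w wn p0.
have -> : - (cyl_pr w * ln (cyl_pr w)) + ln (V w) * cyl_pr w =
  cyl_pr w * ln (V w / cyl_pr w) by rewrite ln_div ?posrE//; ring.
have -> : V w - cyl_pr w = cyl_pr w * (V w / cyl_pr w - 1) by field; rewrite gt_eqF.
by rewrite ler_pM2l// -ler_expR lnK ?posrE ?divr_gt0// (le_trans _ (expR_ge1Dx _))// addrC subrK.
Qed.

Lemma word_entropy_ge0 n : 0 <= word_entropy n.
Proof.
apply: sumr_ge0 => w _; rewrite etafunE -mulrN mulr_ge0 ?cyl_pr_ge0// oppr_ge0.
apply: ln_le0; apply: pr_le1; exact: measurable_cylinder.
Qed.

Lemma word_entropyE n : word_entropy n = mean mu (fun x => - ln (cyl_pr (itinerary n x))).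
Proof.
rewrite (mean_itinerary n (fun w => - ln (cyl_pr w))); apply: eq_bigr => w _.
by rewrite etafunE mulNr mulrC.
Qed.

(** Gibbs' inequality against the product of the laws of the first [n] and the last [m] letters;
    invariance identifies the law of the last [m] letters with that of the first [m]. *)
Lemma word_entropyD n m : word_entropy (n + m) <= word_entropy n + word_entropy m.
Proof.
pose V w := cyl_pr (take n w) * cyl_pr (drop n w).
have V1 : \sum_(w <- words (n + m)) V w <= 1.
  rewrite sum_wordsD big_seq (eq_bigr (fun u => cyl_pr u)) -?big_seq ?sum_cyl_pr//.
  move=> u; rewrite mem_words => /eqP un.
  rewrite -[RHS]mulr1 -(sum_cyl_pr m) mulr_sumr; apply: eq_bigr => v _.
  by rewrite /V take_size_cat// drop_size_cat.
have pos w : 0 < cyl_pr w -> 0 < cyl_pr (take n w) /\ 0 < cyl_pr (drop n w).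
  move=> p0; have [h1 h2] := cyl_pr_cat_le (take n w) (drop n w).
  by rewrite cat_take_drop in h1 h2; split; exact: lt_le_trans p0 _.
apply: le_trans (word_entropy_gibbs _ _ V1) _.
- by move=> w; rewrite mulr_ge0 ?cyl_pr_ge0.
- by move=> w _ /pos[? ?]; rewrite mulr_gt0.
have bn := bounded_measurable_itinerary n (fun w => - ln (cyl_pr w)).
have bm := bounded_measurable_itinerary m (fun w => - ln (cyl_pr w)).
rewrite 2!word_entropyE -(mean_iter mT Tinv n bm) -meanD//; last first.
  exact: (bounded_measurable_iter mT n bm).
pose F w := - ln (cyl_pr (take n w)) - ln (cyl_pr (drop n w)).
rewrite (_ : (fun x => _) = fun x => F (itinerary (n + m) x)); last first.
  apply/funext => x; rewrite /F itineraryD.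
  by rewrite take_size_cat ?drop_size_cat ?size_itinerary.
rewrite mean_itinerary; apply: ler_sum => w _.
have [/pos[h1 h2]|p0] := ltP 0 (cyl_pr w).
  by rewrite /V /F lnM ?posrE// opprD.
have -> : cyl_pr w = 0 by apply/eqP; rewrite eq_le p0 cyl_pr_ge0.
by rewrite !mulr0.
Qed.

End Names.

(** * Fekete's lemma *)

Section Fekete.
Context {R : realType}.
Variable H : nat -> R.
Hypotheses (H0 : forall n, 0 <= H n) (HD : forall n m, H (n + m)%N <= H n + H m).

(** The limit is the infimum over positive indices: division of [n] by a nearly optimal [m.+1]
    leaves a remainder of bounded cost. *)
Lemma fekete_cvgn : cvgn ((fun n => H n / n%:R) : nat -> R^o).
Proof.
pose S := [set H n.+1 / n.+1%:R | n in setT].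
have hS : has_inf S.
  by split; [exists (H 1 / 1); exists 0%N|exists 0 => _ [n _ <-]; rewrite divr_ge0].
apply/cvg_ex; exists (inf S); apply/cvgrPdist_le => /= e e0.
have [_ [m _ <-] Hm] := inf_adherent (divr_gt0 e0 (ltr0Sn R 1)) hS.
have Hmul q : H (q * m.+1) <= q%:R * H m.+1 + H 0.
  elim: q => [|q IH]; first by rewrite mul0r add0r.
  by rewrite mulSn (le_trans (HD _ _))// -nat1r mulrDl mul1r -addrA lerD2l.
have Hlin r : H r <= r%:R * H 1 + H 0.
  elim: r => [|r IH]; first by rewrite mul0r add0r.
  by rewrite -add1n (le_trans (HD _ _))// natrD mulrDl mul1r -addrA lerD2l.
pose C := m.+1%:R * H 1 + 2 * H 0.
exists ((Num.truncn (C / (e / 2))).+1) => // n /= Nn.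
have n0 : (0 < n)%N by lia.
have n0R : 0 < n%:R :> R by rewrite ltr0n.
have lb : inf S <= H n / n%:R.
  by apply: ge_inf; [exact: hS.2|exists n.-1 => //; rewrite prednK].
rewrite distrC ger0_norm ?subr_ge0// lerBlDr.
have Cn : C / n%:R <= e / 2.
  rewrite ler_pdivrMr// mulrC -ler_pdivrMr ?divr_gt0//.
  by rewrite ltW// (lt_le_trans (truncnS_gt _))// ler_nat.
have nE : (n = n %/ m.+1 * m.+1 + n %% m.+1)%N by exact: divn_eq.
have : H n <= n%:R * (H m.+1 / m.+1%:R) + C.
  rewrite [in leLHS]nE (le_trans (HD _ _))//.
  have := Hmul (n %/ m.+1)%N; have := Hlin (n %% m.+1)%N.
  have : (n %% m.+1)%:R * H 1 <= m.+1%:R * H 1.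
    by rewrite ler_wpM2r// ler_nat ltnW// ltn_mod.
  have : (n %/ m.+1)%:R * H m.+1 <= n%:R * (H m.+1 / m.+1%:R).
    rewrite mulrCA mulrC ler_wpM2l// ler_pdivlMr// -natrM ler_nat; exact: leq_divM.
  by rewrite /C; move: (n%:R * (H m.+1 / m.+1%:R)) => Z; lra.
move=> h; have : H n / n%:R <= H m.+1 / m.+1%:R + C / n%:R.
  by rewrite ler_pdivrMr// mulrDl divfK ?gt_eqF// mulrC.
move: (H m.+1 / m.+1%:R) Hm => Z; lra.
Qed.

End Fekete.

Section SubadditiveLimit.
Context {R : realType}.
Variable H : nat -> R.
Hypotheses (H0 : forall n, 0 <= H n) (HD : forall n m, H (n + m)%N <= H n + H m).
Let L : R := limn ((fun n => H n / n%:R) : nat -> R^o).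

Lemma limn_subadditive_le (a D : R) : (forall n, H n <= n%:R * a + D) -> L <= a.
Proof.
move=> Ha; apply/ler_addgt0Pr => e e0.
apply: limr_le; first exact: fekete_cvgn.
exists (Num.truncn (D / e)).+1 => // n /= Nn.
have n0 : 0 < n%:R :> R by rewrite ltr0n; lia.
have : D <= n%:R * e.
  by rewrite -ler_pdivrMr// ltW// (lt_le_trans (truncnS_gt _))// ler_nat.
by rewrite ler_pdivrMr//; have := Ha n; lra.
Qed.

(** Blocks of near-optimal entropy can be taken arbitrarily long, which makes a fixed cost per block
    negligible. *)
Lemma limn_subadditive_ge (e : R) (N : nat) : 0 < e ->
  exists2 m, (N < m)%N & H m <= m%:R * (L + e).
Proof.
move=> e0; have := fekete_cvgn H0 HD.
move=> /(@cvgrPdist_lt _ _ _ _ _ _ _) /(_ e e0) [M _ HM].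
exists (maxn N M).+1; first by rewrite ltnS leq_maxl.
have /= := HM (maxn N M).+1 _; rewrite -/L ltr_distlC => /(_ _)/andP[|_].
  by rewrite (leq_trans (leq_maxr N M)).
by rewrite ltr_pdivrMr ?ltr0n// mulrC => /ltW.
Qed.

End SubadditiveLimit.

(** * A sub-probability that charges typical itineraries *)

Section Coding.
Context {d : measure_display} {X : measurableType d} {R : realType} {A : finType}.
Variables (mu : probability X R) (T : X -> X) (code : X -> A).
Hypothesis mT : measurable_fun setT T.
Hypothesis Tinv : forall B, measurable B -> mu (T @^-1` B) = mu B.
Hypothesis Terg : forall A, measurable A -> T @^-1` A = A -> mu A = 0%E \/ mu A = 1%E.
Hypothesis mcode : forall a, measurable (code @^-1` [set a]).
Local Notation H := (word_entropy mu T code).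

Definition entropy_rate : R := limn ((fun n => H n / n%:R) : nat -> R^o).

Let cardA : 0 < #|A|%:R :> R.
Proof. by rewrite ltr0n; apply/card_gt0P; exists (code point). Qed.

Section ParseItinerary.
Variables (r : seq A -> R) (rho : R).
Hypotheses (r0 : forall w, 0 <= r w) (rho0 : 0 < rho) (r1 : forall a, rho <= r [:: a]).

Lemma parse_weight_gt0 w : 0 < parse_weight r w.
Proof.
elim: w => [|a w IH]; first by rewrite parse_weight_nil ltr01.
rewrite -cat1s; apply: lt_le_trans (parse_weight_cat r0 _ _).
by rewrite mulr_gt0// (lt_le_trans rho0)// (le_trans (r1 a))// parse_weight_ge.
Qed.

Lemma ln_parse_superadditive :
  superadditive T (fun n x => ln (parse_weight r (itinerary T code n x))).
Proof.
split=> [x|n m x]; first by rewrite parse_weight_nil ln1.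
rewrite itineraryD -lnM ?posrE ?parse_weight_gt0//.
by rewrite ler_ln ?posrE ?mulr_gt0 ?parse_weight_gt0// parse_weight_cat.
Qed.

Lemma ln_parse1_ge x : ln rho <= ln (parse_weight r (itinerary T code 1 x)).
Proof.
rewrite ler_ln ?posrE ?parse_weight_gt0//.
by rewrite (le_trans (r1 (code x)))// parse_weight_ge.
Qed.

Lemma mean_ln_parse_le n : \sum_(w <- words n) parse_weight r w <= 1 ->
  mean mu (fun x => ln (parse_weight r (itinerary T code n x))) <= - H n.
Proof.
move=> V1; rewrite (mean_itinerary mu mT mcode n (fun w => ln (parse_weight r w))).
rewrite lerNr -sumrN; under [leRHS]eq_bigr do rewrite -mulNr.
by apply: word_entropy_gibbs => // w; [exact: parse_weight_ge0|rewrite parse_weight_gt0].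
Qed.

End ParseItinerary.

Let sum_unif n : \sum_(w <- @words A n) ((size w == 1%N)%:R / (2 * #|A|%:R)) <=
   (n == 1%N)%:R / 2 :> R.
Proof.
rewrite big_seq (eq_bigr (fun=> (n == 1%N)%:R / (2 * #|A|%:R))); last first.
  by move=> w; rewrite mem_words => /eqP ->.
rewrite -big_seq; have [->|n1] := eqVneq n 1%N; last first.
  by rewrite big1 ?mul0r// => w _; rewrite mul0r.
rewrite sum_words1 sumr_const -mulr_natl.
by rewrite le_eqVlt; apply/orP; left; apply/eqP; field; rewrite gt_eqF.
Qed.

(** The half of the Shannon-McMillan-Breiman theorem that bounds the information of an itinerary
    from above, stated with a single weight [V] for all lengths. Parsing into blocks of length [m]
    makes the mean of [G m] at least [- H m - ln 2]; the one-sided ergodic bound controls the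
    Birkhoff sums of [- G m], and these control [G n] by [superadditive_ge_birkhoff]. *)
Lemma itinerary_weight (eta del : R) : 0 < eta -> 0 < del ->
  exists (V : seq A -> R) (Z : set X) (N : nat),
    [/\ forall w, 0 <= V w, forall n, \sum_(w <- words n) V w <= 1,
        measurable Z, 1 - del < pr mu Z &
        forall x n, Z x -> (N <= n)%N ->
          expR (- (n%:R * (entropy_rate + eta))) <= V (itinerary T code n x)].
Proof.
move=> eta0 del0.
have e4 : 0 < eta / 4 by rewrite divr_gt0.
(* [m] is so long that the factor 1/2 in front of the block law, worth [ln 2] per block, costs at
   most [eta / 4] per letter. *)
have [m Nm Hm] := @limn_subadditive_ge R H (word_entropy_ge0 mu mT mcode)
   (word_entropyD mT Tinv mcode) (eta / 4) (Num.truncn (ln 2 / (eta / 4))) e4.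
rewrite -[limn _]/entropy_rate in Hm.
have m0 : (0 < m)%N by lia.
have m0R : 0 < m%:R :> R by rewrite ltr0n.
have m2 : ln 2 <= m%:R * (eta / 4) :> R.
  by rewrite -ler_pdivrMr// ltW// (lt_le_trans (truncnS_gt _))// ler_nat.
pose p := cyl_pr mu T code.
have p0 w : 0 <= p w by exact: cyl_pr_ge0.
have psum n : \sum_(w <- words n) p w = 1 by exact: sum_cyl_pr.
(* Words are parsed into single letters and blocks of length [m]. *)
pose r w : R := (size w == 1%N)%:R / (2 * #|A|%:R) + (size w == m)%:R * p w / 2.
have A2 : 0 < 2 * #|A|%:R :> R by rewrite mulr_gt0.
have r0 w : 0 <= r w by rewrite addr_ge0 ?divr_ge0 ?mulr_ge0// ltW.
pose rho : R := (2 * #|A|%:R)^-1.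
have rho0 : 0 < rho by rewrite invr_gt0.
have r1 a : rho <= r [:: a] by rewrite /r /= mul1r lerDl divr_ge0// mulr_ge0.
have rsum k : \sum_(l < k) \sum_(u <- words l.+1) r u <= 1.
  apply: (@le_trans _ _ (\sum_(l < k) ((l.+1 == 1%N)%:R / 2 + (l.+1 == m)%:R / 2))).
    apply: ler_sum => l _; rewrite big_split lerD ?sum_unif//.
    rewrite big_seq (eq_bigr (fun w => (l.+1 == m)%:R / 2 * p w)).
      by rewrite -big_seq -mulr_sumr psum mulr1.
    by move=> w; rewrite mem_words => /eqP ->; rewrite mulrAC.
  (* Each length occurs for at most one [l], so single letters and [m]-blocks each have total weight
     at most 1/2, even if [m = 1]. *)
  have cnt j : \sum_(l < k) ((l.+1 == j)%:R / 2) <= 1 / 2 :> R.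
    rewrite -mulr_suml ler_pM2r ?invr_gt0//.
    case: j => [|j]; first by rewrite big1// ler01.
    have [jk|kj] := ltnP j k.
      rewrite (bigD1 (Ordinal jk))//= eqxx big1 ?addr0// => i ij.
      by rewrite eqSS; move: ij; rewrite -val_eqE/= => /negbTE ->.
    by rewrite big1 ?ler01// => i _; rewrite eqSS ltn_eqF// (leq_trans (ltn_ord i)).
  by rewrite big_split/=; have := cnt 1%N; have := cnt m; lra.
pose V := parse_weight r.
have V1 n : \sum_(w <- words n) V w <= 1 by exact: sum_parse_weight_le1.
pose G n x := ln (V (itinerary T code n x)).
have sG : superadditive T G by exact: ln_parse_superadditive rho0 r1.
have bG n : bounded_measurable (G n).
  exact: (bounded_measurable_itinerary mT mcode n (fun w => ln (V w))).
have [D GmD] : exists D : R, forall x, `|G m x| <= D by case: (bG m).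
have G1 x : - (- ln rho) <= G 1%N x by rewrite opprK; exact: ln_parse1_ge.
have [B HB] := superadditive_ge_birkhoff sG G1 m0 (fun x => le_trans (ler_norm _) (GmD x)).
pose f x := -1 * G m x.
have bf : bounded_measurable f by exact: bounded_measurableZ.
(* On words of length [m], [V w >= p w / 2]: the word is parsed as one block. *)
have mf : mean mu f <= H m + ln 2.
  rewrite meanZ// mulN1r (mean_itinerary mu mT mcode m (fun w => ln (V w))).
  rewrite [X in _ + X](_ : _ = \sum_(w <- words m) ln 2 * p w); last first.
    by rewrite -mulr_sumr psum mulr1.
  rewrite -sumrN -big_split/=.
  rewrite big_seq [leRHS]big_seq; apply: ler_sum => w; rewrite mem_words => /eqP wm.
  rewrite etafunE -/(p w).
  have [pw|pw] := ltP 0 (p w); last first.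
    have -> : p w = 0 by apply/eqP; rewrite eq_le pw p0.
    by rewrite !mulr0 mul0r oppr0 addr0.
  have : ln (p w / 2) <= ln (V w).
    rewrite ler_ln ?posrE ?divr_gt0 ?(parse_weight_gt0 r0 rho0 r1)//.
    rewrite (le_trans _ (parse_weight_ge r0 _))//; last by rewrite -size_eq0 wm -lt0n.
    by rewrite /r wm eqxx mul1r lerDr divr_ge0// ltW.
  rewrite ln_div ?posrE// => h; have := ler_wpM2r (ltW pw) h; lra.
have hb n : mean mu (birkhoff_sum T f n) <= n%:R * mean mu f.
  by rewrite (mean_birkhoff mT Tinv).
have [Z [mZ prZ] [N HN]] := @superadditive_eventually_lt _ _ _ mu T mT Tinv Terg
  (birkhoff_sum T f) (mean mu f) (m%:R * (eta / 4)) del (birkhoff_sum_superadditive T f)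
  (fun n => bounded_measurable_birkhoff mT n bf)
  hb (mulr_gt0 m0R e4) del0.
exists V, Z, (maxn N (Num.truncn (B / (m%:R * (eta / 4)))).+1); split=> //.
  exact: parse_weight_ge0.
move=> x n Zx; rewrite geq_max => /andP[Nn Bn].
have Vp : 0 < V (itinerary T code n x) by exact: (parse_weight_gt0 r0 rho0 r1).
rewrite -[leRHS]lnK ?posrE// ler_expR -(ler_pM2l m0R).
have := HB n x; have := HN x n Zx Nn.
have -> : birkhoff_sum T f n x = - birkhoff_sum T (G m) n x.
  by rewrite /birkhoff_sum -sumrN; apply: eq_bigr => i _; rewrite /f mulN1r.
have : B <= n%:R * (m%:R * (eta / 4)).
  rewrite -ler_pdivrMr ?mulr_gt0// ltW// (lt_le_trans (truncnS_gt _))// ler_nat//.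
(* The three quarters are the near-optimality of [m], the factor 1/2 and the ergodic bound; the last
   quarter absorbs the constant [B]. *)
have : n%:R * (mean mu f + m%:R * (eta / 4)) <=
       n%:R * (m%:R * (entropy_rate + eta * 3 / 4)).
  by rewrite ler_wpM2l//; lra.
rewrite /G; move: (ln _) => g; lra.
Qed.

End Coding.

(** * An entropy bound from blocks that predict itineraries *)

Section Blocks.
Context {d : measure_display} {X : measurableType d} {R : realType} {A : finType}.
Variables (mu : probability X R) (T : X -> X) (code : X -> A).
Hypothesis mT : measurable_fun setT T.
Hypothesis Tinv : forall B, measurable B -> mu (T @^-1` B) = mu B.
Hypothesis Terg : forall A, measurable A -> T @^-1` A = A -> mu A = 0%E \/ mu A = 1%E.
Hypothesis mcode : forall a, measurable (code @^-1` [set a]).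

Let cardA : 0 < #|A|%:R :> R.
Proof. by rewrite ltr0n; apply/card_gt0P; exists (code point). Qed.

(* The law of a noisy observation of the itinerary predicted along the orbit of [x]:
   each letter is replaced, with probability [kappa], by a uniformly distributed one. *)
Fixpoint noisy_law (pred : X -> A) (kappa : R) (x : X) (w : seq A) : R :=
  if w is b :: w' then
    (kappa / #|A|%:R + (1 - kappa) * (b == pred x)%:R) * noisy_law pred kappa (T x) w'
  else 1.

Variables (pred : X -> A) (kappa : R).
Hypothesis kappa01 : 0 < kappa < 1.

Let kA0 : 0 < kappa / #|A|%:R.
Proof. by case/andP: kappa01 => k0 _; rewrite divr_gt0. Qed.

Let step_gt0 b x : 0 < kappa / #|A|%:R + (1 - kappa) * (b == pred x)%:R.
Proof.
by case/andP: kappa01 => k0 k1; rewrite ltr_pwDl// mulr_ge0// subr_ge0 ltW.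
Qed.

Lemma noisy_law_gt0 x w : 0 < noisy_law pred kappa x w.
Proof. by elim: w x => [|b w IH] x //=; rewrite mulr_gt0. Qed.

Lemma sum_noisy_law n x : \sum_(w <- words n) noisy_law pred kappa x w = 1.
Proof.
elim: n x => [|n IH] x; first by rewrite big_seq1.
rewrite sum_wordsS (eq_bigr (fun a => kappa / #|A|%:R + (1 - kappa) * (a == pred x)%:R)).
  rewrite big_split/= sumr_const -mulr_sumr (bigD1 (pred x))//= eqxx big1; last first.
    by move=> a /negbTE ->.
  have -> : (kappa / #|A|%:R) *+ #|A| = kappa.
    by rewrite -[LHS]mulr_natr divfK ?gt_eqF.
  by rewrite addr0 mulr1 addrC subrK.
by move=> a _; rewrite -mulr_sumr IH mulr1.
Qed.

(** A time in [K], being predicted correctly, contributes a factor at least [1 - kappa]; each other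
    time contributes at least [kappa] divided by the number of letters. *)
Lemma noisy_law_itinerary_ge (K : set X) n x y :
  (forall j, (j < n)%N -> K (iter j T y) -> code (iter j T y) = pred (iter j T x)) ->
  n%:R * ln (1 - kappa) - ln (#|A|%:R / kappa) * birkhoff_sum T \1_(~` K) n y <=
  ln (noisy_law pred kappa x (itinerary T code n y)).
Proof.
case/andP: kappa01 => k0 k1; elim: n x y => [|n IH] x y h.
  by rewrite /birkhoff_sum big_ord0 mulr0 mul0r subr0 ln1.
rewrite -add1n birkhoff_sumD birkhoff_sum1/= lnM ?posrE ?noisy_law_gt0//.
have {}IH := IH (T x) (T y) _.
have /IH {}IH : forall j : nat, (j < n)%N -> K (iter j T (T y)) ->
    code (iter j T (T y)) = pred (iter j T (T x)).
  by move=> j jn; have := h j.+1 jn; rewrite !iterSr.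
rewrite mulrDr natrD mulrDl mul1r.
suff : ln (1 - kappa) - ln (#|A|%:R / kappa) * \1_(~` K) y <=
    ln (kappa / #|A|%:R + (1 - kappa) * (code y == pred x)%:R) by lra.
have [Ky|Ky] := pselect (K y).
  rewrite (h 0%N)// eqxx mulr1 indicE memNset; last by move=> /(_ Ky).
  by rewrite mulr0 subr0 ler_ln ?posrE ?subr_gt0// ?lerDr ?ltW// addr_gt0// subr_gt0.
rewrite indicE mem_set// mulr1.
have -> : - ln (#|A|%:R / kappa) = ln (kappa / #|A|%:R).
  by rewrite -lnV ?posrE ?divr_gt0// invf_div.
have : ln (kappa / #|A|%:R) <= ln (kappa / #|A|%:R + (1 - kappa) * (code y == pred x)%:R).
  by rewrite ler_ln ?posrE// lerDl mulr_ge0// subr_ge0 ltW.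
have : ln (1 - kappa) <= 0 by apply: ln_le0; lra.
lra.
Qed.

(** The core of the lower bounds. The pairs of [t] are centres with lengths, [om] their weights.
    Parsing into letters and noisy copies of the itineraries of the centres yields a sub-probability
    whose logarithm is large on the blocks starting in [F']; the tiling bounds its mean from below,
    and Gibbs' inequality bounds it from above by minus the entropy. *)
Lemma entropy_rate_le_blocks (psi : X -> R) (K F : set X) (s tau : R) :
  bounded_measurable psi -> measurable K -> measurable F -> 0 < pr mu F -> 0 < tau ->
  exists N0 : nat, exists2 rho : R, 0 < rho &
  forall (t : seq (X * nat)) (om : X * nat -> R) (F' : set X) (M : nat),
    measurable F' -> F' `<=` F -> pr mu F - rho <= pr mu F' ->
    (forall p, 0 < om p) -> \sum_(p <- t) om p <= 1 / 2 ->
    (forall y, F' y -> exists2 p, p \in t & [/\ (N0 <= p.2 <= M)%N,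
       birkhoff_sum T psi p.2 y - p.2%:R * s <= ln (om p) &
       forall j, (j < p.2)%N -> K (iter j T y) -> code (iter j T y) = pred (iter j T p.1)]) ->
  entropy_rate mu T code <=
    s + tau - mean mu psi - ln (1 - kappa) + ln (#|A|%:R / kappa) * pr mu (~` K).
Proof.
move=> bpsi mK mF F0 tau0; case/andP: (kappa01) => k0 k1.
have [Cpsi psiC] : exists C : R, forall x, `|psi x| <= C by case: bpsi.
have Cpsi0 : 0 <= Cpsi by rewrite (le_trans _ (psiC point)).
have A2 : 0 < 2 * #|A|%:R :> R by rewrite mulr_gt0.
pose rh : R := (2 * #|A|%:R)^-1.
have rh0 : 0 < rh by rewrite invr_gt0.
pose C := `|ln rh| + Cpsi; have C0 : 0 <= C by rewrite addr_ge0.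
set Mc := ln (#|A|%:R / kappa).
have Mc0 : 0 <= Mc.
  apply: ln_ge0; rewrite ler_pdivlMr// mul1r (le_trans (ltW k1))// ler1n.
  by rewrite -(ltr0n R).
pose c := - s + ln (1 - kappa).
have [N0 [rho rho0 HN]] := ergodic_superadditive_mean_ge mT Tinv Terg c mF F0 C0 tau0.
(* Length at least 1 makes the itinerary of a block nonempty, as [parse_weight_ge] requires. *)
exists (maxn N0 1), rho => //.
move=> t om F' M mF' F'F prF' om0 om1 hF'.
(* Words are parsed into single letters and noisy itineraries of the centres [p.1]. *)
pose r w : R := (size w == 1%N)%:R / (2 * #|A|%:R) +
  \sum_(p <- t) (p.2 == size w)%:R * (om p * noisy_law pred kappa p.1 w).
have sp0 (t' : seq (X * nat)) w :
    0 <= \sum_(p <- t') (p.2 == size w)%:R * (om p * noisy_law pred kappa p.1 w).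
  by apply: sumr_ge0 => p _; rewrite !mulr_ge0// ltW// noisy_law_gt0.
have r0 w : 0 <= r w by rewrite addr_ge0 ?sp0// divr_ge0// ltW.
have r1 a : rh <= r [:: a] by rewrite /r eqxx mul1r lerDl sp0.
have rsum k : \sum_(l < k) \sum_(u <- words l.+1) r u <= 1.
  (* The pair [p] emits only words of length [p.2], of total weight [om p] since the noisy law is a
     probability; letters and blocks thus have weight at most 1/2 each. *)
  have E1 l : \sum_(u <- words l.+1) r u =
     (l.+1 == 1%N)%:R / 2 + \sum_(p <- t) (p.2 == l.+1)%:R * om p.
    rewrite big_split/=; congr (_ + _).
      have [->|l1] := eqVneq l 0%N.
        rewrite sum_words1 /= sumr_const -[LHS]mulr_natl.
        by field; rewrite gt_eqF.
      rewrite eqSS (negbTE l1) mul0r big_seq big1// => w; rewrite mem_words => /eqP ->.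
      by rewrite eqSS (negbTE l1) mul0r.
    rewrite exchange_big; apply: eq_bigr => p _.
    rewrite big_seq (eq_bigr (fun w =>
      ((p.2 == l.+1)%:R * om p) * noisy_law pred kappa p.1 w)).
      by rewrite -big_seq -mulr_sumr sum_noisy_law mulr1.
    by move=> w; rewrite mem_words => /eqP ->; rewrite mulrA.
  have cnt j : \sum_(l < k) (j == l.+1)%:R <= 1 :> R.
    case: j => [|j]; first by rewrite big1// ler01.
    have [jk|kj] := ltnP j k.
      rewrite (bigD1 (Ordinal jk))//= eqxx big1 ?addr0// => i ij.
      by rewrite eqSS eq_sym; move: ij; rewrite -val_eqE/= => /negbTE ->.
    by rewrite big1 ?ler01// => i _; rewrite eqSS gtn_eqF// (leq_trans (ltn_ord i)).
  under eq_bigr do rewrite E1; rewrite big_split/=.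
  have : \sum_(l < k) ((l.+1 == 1%N)%:R / 2) <= 1 / 2 :> R.
    rewrite -mulr_suml ler_pM2r ?invr_gt0//.
    by under eq_bigr do rewrite eq_sym; exact: cnt.
  have : \sum_(l < k) \sum_(p <- t) (p.2 == l.+1)%:R * om p <= \sum_(p <- t) om p.
    rewrite exchange_big; apply: ler_sum => p _.
    by rewrite -mulr_suml ler_piMl// ltW.
  lra.
pose V := parse_weight r.
have V1 n : \sum_(w <- words n) V w <= 1 by exact: sum_parse_weight_le1.
pose G n x := ln (V (itinerary T code n x)).
have bG n : bounded_measurable (G n).
  exact: (bounded_measurable_itinerary mT mcode n (fun w => ln (V w))).
(* Adding the Birkhoff sums of [g] to [G] cancels the terms in [psi] and in the indicator of the
   complement of [K], so that a block of length [n] starting in [F'] is worth at least [n c]. *)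
pose g x := -1 * psi x + Mc * \1_(~` K) x.
have bI : bounded_measurable (\1_(~` K) : X -> R).
  by apply: bounded_measurable_indic; exact: measurableC.
have bg : bounded_measurable g.
  by apply: bounded_measurableD; exact: bounded_measurableZ.
pose phi n x := G n x + birkhoff_sum T g n x.
have sphi : superadditive T phi.
  apply: superadditiveD; last exact: birkhoff_sum_superadditive.
  exact: ln_parse_superadditive rh0 r1.
have bphi n : bounded_measurable (phi n).
  by apply: bounded_measurableD => //; exact: bounded_measurable_birkhoff.
have gE n x : birkhoff_sum T g n x =
    - birkhoff_sum T psi n x + Mc * birkhoff_sum T \1_(~` K) n x.
  rewrite /birkhoff_sum -sumrN mulr_sumr -big_split/=.
  by apply: eq_bigr => i _; rewrite /g mulN1r.
have phi1 x : - C <= phi 1%N x.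
  rewrite /phi gE birkhoff_sum1.
  have : ln rh <= G 1%N x by apply: ln_parse1_ge.
  have := ler_norm (- ln rh); rewrite normrN.
  have := le_trans (ler_norm (psi x)) (psiC x).
  have : 0 <= Mc * birkhoff_sum T \1_(~` K) 1 x.
    by rewrite mulr_ge0// birkhoff_sum1 indicE.
  rewrite /C; lra.
have hphi y : F' y -> exists2 n, (N0 <= n <= M)%N & n%:R * c <= phi n y.
  move=> F'y; have [p pt [/andP[N0p pM] hom hK]] := hF' y F'y.
  move: N0p; rewrite geq_max => /andP[N0p p1].
  exists p.2; first by rewrite N0p.
  have := noisy_law_itinerary_ge hK; set q := noisy_law _ _ _ _ => hq.
  have q0 : 0 < q by exact: noisy_law_gt0.
  have : ln (om p) + ln q <= G p.2 y.
    rewrite -lnM ?posrE// ler_ln ?posrE ?mulr_gt0//; last first.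
      exact: (parse_weight_gt0 r0 rh0 r1).
    apply: le_trans (parse_weight_ge r0 _); last first.
      by rewrite -size_eq0 size_itinerary -lt0n.
    rewrite /r size_itinerary ler_wpDl ?(divr_ge0 _ (ltW A2))//.
    rewrite (perm_big _ (perm_to_rem pt))/= big_cons eqxx mul1r -/q lerDl.
    by have := sp0 (rem p t) (itinerary T code p.2 y); rewrite size_itinerary.
  by rewrite /phi gE /c; rewrite -/Mc in hq; lra.
have [D HD] := HN phi F' M sphi bphi phi1 mF' F'F prF' hphi.
apply: (@limn_subadditive_le R _ (word_entropy_ge0 mu mT mcode)
  (word_entropyD mT Tinv mcode) _ D) => n.
have := HD n; rewrite meanD//; last exact: bounded_measurable_birkhoff.
have : mean mu (G n) <= - word_entropy mu T code n.
  exact: (mean_ln_parse_le mu mT mcode r0 rh0 r1 (V1 n)).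
rewrite (mean_birkhoff mT Tinv)// meanD; last 2 first.
- exact: bounded_measurableZ.
- exact: bounded_measurableZ.
rewrite !meanZ// mean_indic; last exact: measurableC.
rewrite -/(pr mu (~` K)) /c; move: (ln (1 - kappa)) (mean mu (G n)) => u v; lra.
Qed.

End Blocks.

(** * Compact metric spaces *)

Section CompactMetric.
Context {R : realType} {X : pointedType} (d : X -> X -> R).
Hypotheses (dm : is_metric d) (dc : dcompact d).

Lemma dist_self x : d x x = 0. Proof. by case: dm => /(_ x x)[_ ->]. Qed.
Lemma dist_sym x y : d x y = d y x. Proof. by case: dm. Qed.
Lemma dist_triangle y x z : d x z <= d x y + d y z. Proof. by case: dm. Qed.

Lemma dopen_ball x r : dopen d [set y | d x y < r].
Proof.
move=> y /= xy; exists (r - d x y); first by rewrite subr_gt0.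
by move=> z yz /=; have := dist_triangle y x z; lra.
Qed.

Lemma finite_ball_cover (r : X -> R) : (forall x, 0 < r x) ->
  exists s : seq X, forall y, exists2 x, x \in s & d x y < r x.
Proof.
move=> r0; pose b x := [set y | d x y < r x].
have [||S [SF Sc]] := dc (F := [set U | exists x, U = b x]).
- by move=> _ [x ->]; exact: dopen_ball.
- by move=> x; exists (b x); [exists x|rewrite /b/= dist_self].
have /choice [c Hc] : forall U, exists x, (U \in S) -> U = b x.
  move=> U; have [/SF[x ->]|] := boolP (U \in S); first by exists x.
  by exists point.
exists (map c S) => y; have [U US Uy] := Sc y.
by exists (c U); [exact: map_f|rewrite (Hc U US) in Uy].
Qed.

(** Finitely many balls of half radius cover the space; [e] is at most the smallest of these half
    radii. *)
Lemma lebesgue_number (r : X -> R) : (forall x, 0 < r x) ->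
  exists2 e : R, 0 < e & forall y, exists x, forall z, d y z < e -> d x z < r x.
Proof.
move=> r0; have r20 x : 0 < r x / 2 by rewrite divr_gt0.
have [s Hs] := finite_ball_cover r20.
have [e e0 He] : exists2 e : R, 0 < e & forall x, x \in s -> e <= r x / 2.
  elim: (s) => [|x s' [e e0 He]]; first by exists 1.
  exists (Num.min e (r x / 2)); first by rewrite lt_min e0 r20.
  move=> z; rewrite inE => /predU1P[->|/He ez]; first by rewrite ge_min lexx orbT.
  by rewrite ge_min ez.
exists e => // y; have [x xs xy] := Hs y; exists x => z yz.
by have := dist_triangle y x z; have := He x xs; lra.
Qed.

Lemma uniform_continuity (f : X -> R) (e : R) : dcontinuous_fun d f -> 0 < e ->
  exists2 r : R, 0 < r & forall x y, d x y < r -> `|f x - f y| < e.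
Proof.
move=> cf e0; have e20 : 0 < e / 2 by rewrite divr_gt0.
have /choice[r Hr] : forall x, exists r : R, 0 < r /\ forall y, d x y < r -> `|f x - f y| < e / 2.
  by move=> x; have [r r0 Hr] := cf x _ e20; exists r.
have [rho rho0 Hrho] := lebesgue_number (fun x => (Hr x).1).
exists rho => // y z yz; have [x Hx] := Hrho y.
have h1 := (Hr x).2 z (Hx z yz).
have /(Hr x).2 h2 : d x y < r x by apply: Hx; rewrite dist_self.
have -> : f y - f z = (f x - f z) - (f x - f y) by ring.
by rewrite (le_lt_trans (ler_normB _ _))//; lra.
Qed.

Lemma continuous_bounded (f : X -> R) : dcontinuous_fun d f ->
  exists C : R, forall x, `|f x| <= C.
Proof.
move=> cf; have /choice[r Hr] :
    forall x, exists r : R, 0 < r /\ forall y, d x y < r -> `|f x - f y| < 1.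
  by move=> x; have [r r0 Hr] := cf x 1 ltr01; exists r.
have [s Hs] := finite_ball_cover (fun x => (Hr x).1).
exists (\sum_(x <- s) (`|f x| + 1)) => y; have [x xs xy] := Hs y.
have h := (Hr x).2 y xy; rewrite (perm_big _ (perm_to_rem xs))/= big_cons.
have : 0 <= \sum_(z <- rem x s) (`|f z| + 1) by apply: sumr_ge0 => z _; rewrite addr_ge0.
have -> : f y = f x - (f x - f y) by ring.
by have := ler_normB (f x) (f x - f y); lra.
Qed.

(** Each [x] has a ball that misses every [K l] not containing [x]. Two points at distance below the
    Lebesgue number lie in a common such ball, so the sets they belong to share its centre. *)
Lemma closed_separation (A : finType) (K : A -> set X) :
  (forall l, dopen d (~` K l)) -> (forall l l' x, K l x -> K l' x -> l = l') ->
  exists2 e : R, 0 < e &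
    forall l l' x y, K l x -> K l' y -> d x y < e -> l = l'.
Proof.
move=> cK dK.
have Kr x l : exists r : R, 0 < r /\ (~ K l x -> forall y, d x y < r -> ~ K l y).
  have [Kx|/cK[r r0 Hr]] := pselect (K l x); first by exists 1.
  by exists r.
have /choice[r Hr] : forall x, exists r : R, 0 < r /\
    forall l, ~ K l x -> forall y, d x y < r -> ~ K l y.
  move=> x; have /choice[r Hr] := Kr x.
  exists (\big[Num.min/1]_l r l); split.
    by elim/big_ind: _ => // [a b a0 b0|l _]; [rewrite lt_min a0|have [] := Hr l].
  move=> l Kx y xy; apply: (Hr l).2 => //; apply: lt_le_trans xy _.
  by rewrite (bigD1 l)//= ge_min lexx.
have [e e0 He] := lebesgue_number (fun x => (Hr x).1).
exists e => // l l' y z Ky Kz yz; have [x Hx] := He y.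
have h l1 z1 : d y z1 < e -> K l1 z1 -> K l1 x.
  move=> yz1 Kz1; have [//|nK] := pselect (K l1 x).
  by have := (Hr x).2 l1 nK z1 (Hx z1 yz1) Kz1.
apply: (dK _ _ x); last exact: h Kz.
by apply: (h _ y) => //; rewrite dist_self.
Qed.

Lemma dopenI (U V : set X) : dopen d U -> dopen d V -> dopen d (U `&` V).
Proof.
move=> oU oV x [/oU[e e0 H] /oV[r r0 H']]; exists (Num.min e r); first by rewrite lt_min e0.
by move=> y; rewrite lt_min => /andP[/H Uy /H' Vy].
Qed.

Lemma dopen_bigcup (I : Type) (D : set I) (U : I -> set X) :
  (forall i, dopen d (U i)) -> dopen d (\bigcup_(i in D) U i).
Proof. by move=> oU x [i Di /oU[e e0 H]]; exists e => // y /H Uy; exists i. Qed.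

End CompactMetric.

(** * Borel measurability and regularity of the measure *)

Section BorelSets.
Context {R : realType} {X : pointedType} {d : X -> X -> R}.
Hypothesis dm : is_metric d.
Local Notation B := (Borel d).

Lemma dopen_measurable (U : set B) : dopen d U -> measurable U.
Proof. exact: sub_sigma_algebra. Qed.

Lemma dclosed_measurable (K : set B) : dopen d (~` K) -> measurable K.
Proof. by move=> oK; rewrite -(setCK K); apply: measurableC; exact: dopen_measurable. Qed.

Lemma dcontinuous_fun_measurable (f : B -> R) : dcontinuous_fun d f -> measurable_fun setT f.
Proof.
move=> cf _; apply: (measurability _ (RGenOInfty.measurableE R)) => //.
move=> _ [_ [a ->] <-]; rewrite setTI; apply: dopen_measurable => x /=.
rewrite in_itv/= andbT => ax.
have [r r0 H] := cf x (f x - a) (etrans (subr_gt0 _ _) ax).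
exists r => // y /H; rewrite /= in_itv/= andbT => h.
by have := ler_norm (f x - f y); lra.
Qed.

Lemma dcontinuous_map_preimage (T : X -> X) (U : set X) :
  dcontinuous_map d T -> dopen d U -> dopen d (T @^-1` U).
Proof.
move=> cT oU x /oU[e e0 H]; have [r r0 Hr] := cT x e e0.
by exists r => // y /Hr /H.
Qed.

Lemma dcontinuous_map_measurable (T : B -> B) : dcontinuous_map d T -> measurable_fun setT T.
Proof.
move=> cT; apply: (@measurability _ _ B B setT T (dopen d)) => //.
by move=> _ [U oU <-]; rewrite setTI; apply: dopen_measurable; exact: dcontinuous_map_preimage.
Qed.

Lemma dcontinuous_map_iter (T : X -> X) n : dcontinuous_map d T -> dcontinuous_map d (iter n T).
Proof.
move=> cT; elim: n => [|n IH] x e e0; first by exists e.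
have [r r0 H] := cT (iter n T x) e e0; have [q q0 H'] := IH x r r0.
by exists q => // y /H' /H.
Qed.

Lemma dopen_bowen_ball (T : X -> X) n x eps : dcontinuous_map d T ->
  dopen d (bowen_ball d T n x eps).
Proof.
move=> cT; elim: n => [|n IH]; first by move=> y _; exists 1.
have := dopenI IH (dcontinuous_map_preimage (dcontinuous_map_iter n cT)
  (@dopen_ball _ _ _ dm (iter n T x) eps)).
congr dopen; apply/seteqP; split => y.
  by move=> [h1 h2] i; rewrite ltnS leq_eqVlt => /predU1P[->|/h1].
by move=> h; split => [i ni|]; [apply: h; exact: ltnW|exact: h].
Qed.

Variable mu : probability B R.

(** The approximation is from both sides, which makes the property stable under complements. *)
Definition closed_open_regular (A : set B) := forall e : R, 0 < e ->
  exists K U : set B, [/\ dopen d (~` K), dopen d U, K `<=` A, A `<=` U & pr mu (U `\` K) < e].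

(** An open set is the increasing union of the closed sets of points at distance at least
    [1 / (n + 1)] from its complement. *)
Lemma dopen_regular (U : set B) : dopen d U -> closed_open_regular U.
Proof.
move=> oU e e0.
pose K (n : nat) : set B := [set x | forall y, d x y < n.+1%:R^-1 -> U y].
have cK n : dopen d (~` K n).
  move=> x /existsNP[y /not_implyP[xy Uy]].
  exists (n.+1%:R^-1 - d x y); first by rewrite subr_gt0.
  move=> z xz /(_ y) Kz; apply: Uy; apply: Kz.
  by have := dist_triangle dm x z y; rewrite (dist_sym dm z x); move: (n.+1%:R^-1) xz => q; lra.
have KU n : K n `<=` U.
  by move=> x /(_ x); apply; rewrite dist_self.
have mK n : measurable (K n) by exact: dclosed_measurable.
have mU := dopen_measurable oU.
have Kmono m n : (m <= n)%N -> K m `<=` K n.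
  move=> mn x Kx y xy; apply: Kx; apply: lt_le_trans xy _.
  by rewrite lef_pV2 ?posrE// ler_nat.
have [n Hn] := pr_bigcup_nondecreasing mu e0 mK Kmono.
exists (K n), U; split => //.
have UE : U `<=` \bigcup_n K n.
  move=> x /oU[r r0 Hr].
  exists (Num.truncn r^-1) => // y xy; apply: Hr; apply: lt_le_trans xy _.
  by rewrite -[leRHS]invrK lef_pV2 ?posrE ?invr_gt0// ltW// truncnS_gt.
have mE : measurable (\bigcup_n K n) by exact: bigcupT_measurable.
have := le_pr mu mU mE UE; have := prDI mu mU (mK n).
by rewrite (setIidr (KU n)); lra.
Qed.

Lemma pr_bigcup_le (F : nat -> set B) (e : R) : (forall n, measurable (F n)) ->
  (forall n, pr mu (F n) <= e / (2 ^+ n.+1)) -> 0 <= e -> pr mu (\bigcup_n F n) <= e.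
Proof.
move=> mF Fe e0; pose G n := \big[setU/set0]_(i < n.+1) F i.
have mG n : measurable (G n) by apply: bigsetU_measurable.
have Gle n : pr mu (G n) <= e - e / 2 ^+ n.+1.
  elim: n => [|n IH]; first by rewrite /G big_ord1; have := Fe 0%N; rewrite expr1; lra.
  rewrite /G big_ord_recr/= (le_trans (prU mu (mG n) (mF n.+1)))//.
  by have := Fe n.+1; rewrite [2 ^+ n.+2]exprS invfM; lra.
apply/ler_addgt0Pr => r r0.
have Gmono m n : (m <= n)%N -> G m `<=` G n.
  move=> mn; rewrite /G -!(bigcup_mkord); apply: bigcup_sub => i /= im.
  by apply: bigcup_sup => /=; exact: leq_trans mn.
have [n] := pr_bigcup_nondecreasing mu r0 mG Gmono.
rewrite [X in pr mu X](_ : _ = \bigcup_n F n).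
  have := Gle n; have : 0 <= e / 2 ^+ n.+1 by rewrite divr_ge0// exprn_ge0.
  lra.
exact: bigcup_bigsetU_bigcup.
Qed.

(** The regular sets form a sigma-algebra that contains the open sets. *)
Lemma measurable_regular (A : set B) : measurable A -> closed_open_regular A.
Proof.
apply: smallest_sub; last exact: dopen_regular.
split.
- move=> e e0; exists set0, set0; rewrite setD0 pr_set0; split => //.
    by rewrite setC0 => x _; exists 1.
- move=> {}A rA e /rA[K [U [cK oU KA AU UK]]]; exists (~` U), (~` K); split => //.
  + by rewrite setCK.
  + by rewrite setTD; exact: subsetC.
  + by rewrite setTD; exact: subsetC.
  + by rewrite setDE setCK setIC -setDE.
move=> F rF e e0; have e20 : 0 < e / 2 by rewrite divr_gt0.
have /choice[K HK] : forall n, exists K : set B, exists U : set B,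
    [/\ dopen d (~` K), dopen d U, K `<=` F n, F n `<=` U &
        pr mu (U `\` K) < (e / 2) / 2 ^+ n.+1].
  by move=> n; apply: rF; rewrite divr_gt0// exprn_gt0.
have /choice[U HU] := HK.
(* A countable union of closed sets need not be closed; a finite part of it is, and a long one loses
   less than [e / 2] in measure. *)
pose G n := \big[setU/set0]_(i < n.+1) K i.
have mK n : measurable (K n) by apply: dclosed_measurable; have [] := HU n.
have oU n : dopen d (U n) by have [] := HU n.
have mU n : measurable (U n) by exact: dopen_measurable.
have mG n : measurable (G n) by apply: bigsetU_measurable.
have Gmono m n : (m <= n)%N -> G m `<=` G n.
  move=> mn; rewrite /G -!(bigcup_mkord); apply: bigcup_sub => i /= im.
  by apply: bigcup_sup => /=; exact: leq_trans mn.
have [n Hn] := pr_bigcup_nondecreasing mu e20 mG Gmono.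
have GE : \bigcup_n G n = \bigcup_n K n by exact: bigcup_bigsetU_bigcup.
have GK : G n `<=` \bigcup_n K n by rewrite -GE; exact: bigcup_sup.
have mUU : measurable (\bigcup_n U n) by exact: bigcupT_measurable.
have mKK : measurable (\bigcup_n K n) by exact: bigcupT_measurable.
exists (G n), (\bigcup_n U n); split.
- rewrite /G; elim: (n.+1) => [|k IH]; first by rewrite big_ord0 setC0 => x _; exists 1.
  by rewrite big_ord_recr/= setCU; apply: dopenI => //; have [] := HU k.
- exact: dopen_bigcup.
- apply: (subset_trans GK) => x [k _ Kx]; exists k => //.
  by have [_ _ h _ _] := HU k; exact: h.
- by move=> x [k _ Fx]; exists k => //; have [_ _ _ h _] := HU k; exact: h.
have : pr mu (\bigcup_n U n `\` \bigcup_n K n) <= e / 2.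
  apply: (@le_trans _ _ (pr mu (\bigcup_n (U n `\` K n)))).
    apply: le_pr; first exact: measurableD.
      by apply: bigcupT_measurable => k; exact: measurableD.
    move=> x [[k _ Ux] nK]; exists k => //; split => // Kx; apply: nK.
    by exists k.
  apply: pr_bigcup_le (ltW e20) => k; first exact: measurableD.
  by have [_ _ _ _ /ltW] := HU k.
have KU : \bigcup_n K n `<=` \bigcup_n U n.
  move=> x [k _ Kx]; exists k => //; have [_ _ h1 h2 _] := HU k.
  exact/h2/h1.
have := prDI mu mUU (mG n); rewrite (setIidr (subset_trans GK KU)).
have := prDI mu mUU mKK; rewrite (setIidr KU); rewrite GE in Hn.
lra.
Qed.

End BorelSets.

(** * Partitions as codings *)

Section PartitionCoding.
Context {R : realType} {X : pointedType} {d : X -> X -> R}.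
Local Notation B := (Borel d).
Variables (T : B -> B) (mu : probability B R).

Lemma nth_ffun_word (A : Type) (a0 : A) n (f : 'I_n -> A) (i : 'I_n) :
  nth a0 [seq f j | j <- enum 'I_n] i = f i.
Proof. by rewrite (nth_map i) ?size_enum_ord// nth_ord_enum. Qed.

Lemma sum_words_ffun (A : finType) n (F : seq A -> R) :
  \sum_(f : {ffun 'I_n -> A}) F [seq f i | i <- enum 'I_n] = \sum_(w <- words n) F w.
Proof.
have inj : injective (fun f : {ffun 'I_n -> A} => [seq f i | i <- enum 'I_n]).
  move=> f g fg; apply/ffunP => i.
  by rewrite -(nth_ffun_word (f i) f i) -(nth_ffun_word (f i) g i) fg.
rewrite [LHS](_ : _ =
    \sum_(w <- [seq [seq f i | i <- enum 'I_n] | f : {ffun 'I_n -> A}]) F w); last first.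
  by rewrite big_map big_enum.
apply: perm_big; apply: uniq_perm.
- by rewrite map_inj_uniq ?enum_uniq.
- exact: uniq_words.
move=> w; rewrite mem_words; apply/mapP/eqP => [[f _ ->]|wn].
  by rewrite size_map size_enum_ord.
case: n w wn {F inj} => [|n] w wn.
  exists [ffun i : 'I_0 => match notF (ltn_ord i) with end]; first by rewrite mem_enum.
  by rewrite (size0nil wn) enum_ord0.
case: w wn => // a w wn.
exists [ffun i : 'I_n.+1 => nth a (a :: w) i]; first by rewrite mem_enum.
apply: (@eq_from_nth _ a); first by rewrite size_map size_enum_ord.
rewrite wn => i ni.
by rewrite (nth_ffun_word a _ (Ordinal ni)) ffunE.
Qed.

Variable xi : seq (set B).
Hypothesis pxi : meas_partition xi.

Lemma partition_code : exists code : B -> 'I_(size xi),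
  forall x (i : 'I_(size xi)), nth set0 xi i x <-> code x = i.
Proof.
case: pxi => mxi dxi cxi.
have /choice[code Hc] : forall x : B, exists i : 'I_(size xi), nth set0 xi i x.
  move=> x; have [A Axi Ax] := cxi x.
  have iA : (index A xi < size xi)%N by rewrite index_mem.
  by exists (Ordinal iA); rewrite /= nth_index.
have dis (x : B) (i j : nat) : (i < j < size xi)%N ->
    nth set0 xi i x -> nth set0 xi j x -> False.
  by move=> ij ix jx; have : (nth set0 xi i `&` nth set0 xi j) x := conj ix jx; rewrite dxi.
exists code => x i; split=> [ix|<-]; last exact: Hc.
apply: val_inj; case: (ltngtP (code x) i) => [lt|lt|//]; exfalso.
  by apply: (dis x (code x) i) => //; rewrite lt ltn_ord.
by apply: (dis x i (code x)) => //; rewrite lt ltn_ord.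
Qed.

Variable code : B -> 'I_(size xi).
Hypothesis codeP : forall x (i : 'I_(size xi)), nth set0 xi i x <-> code x = i.

Lemma measurable_code a : measurable (code @^-1` [set a]).
Proof.
rewrite (_ : _ @^-1` _ = nth set0 xi a); last by apply/seteqP; split => x /codeP.
by case: pxi => mxi _ _; apply: mxi; apply: mem_nth; exact: ltn_ord.
Qed.

Lemma part_entropyE : part_entropy T mu xi = entropy_rate mu T code.
Proof.
rewrite /part_entropy /entropy_rate; congr (limn _); apply/funext => n; congr (_ / _).
rewrite /word_entropy -sum_words_ffun; apply: eq_bigr => w _.
congr (etafun (fine (mu _))); apply/seteqP; split => x.
  move=> h; rewrite /cylinder/= size_map size_enum_ord.
  apply: (@eq_from_nth _ (code x)); first by rewrite size_itinerary size_map size_enum_ord.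
  rewrite size_itinerary => i ni; rewrite nth_itinerary//.
  have /codeP -> := h (Ordinal ni) I.
  by rewrite (nth_ffun_word (code x) w (Ordinal ni)).
rewrite /cylinder/= size_map size_enum_ord => h i _; apply/codeP.
by rewrite -(nth_itinerary T code (code x) x (ltn_ord i)) h nth_ffun_word.
Qed.

End PartitionCoding.

(** * Suprema and comparisons in the extended reals *)

Section EReal.
Context {R : realType}.
Implicit Types (x y : \bar R).

Lemma lte_exists_real x y : (x < y)%E -> exists r : R, (x < r%:E < y)%E.
Proof.
case: x y => [x| |] [y| |] //; rewrite ?lte_fin => xy.
- by exists ((x + y) / 2); rewrite !lte_fin; apply/andP; split; lra.
- by exists (x + 1); rewrite lte_fin ltry andbT; lra.
- by exists (y - 1); rewrite lte_fin ltNyr/=; lra.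
- by exists 0; rewrite ltNyr ltry.
Qed.

(** Reduces an identity whose right-hand side may be infinite to one-sided bounds by real
    numbers. *)
Lemma eq_real_bounds x y : (forall b : R, (y < b%:E)%E -> (x <= b%:E)%E) ->
  (forall a : R, (a%:E < y)%E -> (a%:E <= x)%E) -> x = y.
Proof.
move=> hu hl; apply/eqP; rewrite eq_le !leNgt; apply/andP; split; apply/negP.
  move=> /lte_exists_real[r /andP[yr rx]].
  by have := lt_le_trans rx (hu r yr); rewrite ltxx.
move=> /lte_exists_real[r /andP[yr rx]].
by have := le_lt_trans (hl r rx) yr; rewrite ltxx.
Qed.

(** If all sums were at most [a], the first supremum would be real, nonemptiness excluding both
    infinities, and the sum of the suprema would be at most [a]. *)
Lemma lt_ereal_supD (I J : Type) (D : set I) (E : set J) (f : I -> R) (g : J -> R) (a : R) :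
  D !=set0 -> E !=set0 ->
  (a%:E < ereal_sup [set (f i)%:E | i in D] + ereal_sup [set (g j)%:E | j in E])%E ->
  exists i j, [/\ D i, E j & a < f i + g j].
Proof.
move=> [i0 Di0] [j0 Ej0] ha; apply: contrapT => H.
have fg i j : D i -> E j -> f i + g j <= a.
  by move=> Di Ej; rewrite leNgt; apply/negP => aij; apply: H; exists i, j.
have hf j : E j -> (ereal_sup [set (f i)%:E | i in D] <= (a - g j)%:E)%E.
  move=> Ej; apply: ge_ereal_sup => _ [i Di <-]; rewrite lee_fin.
  by have := fg i j Di Ej; lra.
have f0 : ((f i0)%:E <= ereal_sup [set (f i)%:E | i in D])%E.
  by apply: ereal_sup_ubound; exists i0.
case: (ereal_sup [set (f i)%:E | i in D]) hf f0 ha => [s| |] hf f0 ha; last 2 first.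
- by have := hf j0 Ej0.
- by [].
have : (ereal_sup [set (g j)%:E | j in E] <= (a - s)%:E)%E.
  apply: ge_ereal_sup => _ [j Ej <-]; rewrite lee_fin.
  by have := hf j Ej; rewrite lee_fin; lra.
rewrite EFinB leeBrDl// => /(lt_le_trans ha); by rewrite ltxx.
Qed.

End EReal.

(** * Finite parts of countable covers *)

Section CountableTruncation.
Context {I : choiceType}.

Lemma countable_seq (G : set I) : countable G -> exists t : nat -> seq I,
  [/\ forall n, uniq (t n), forall n p, p \in t n -> G p,
      forall m n, (m <= n)%N -> {subset t m <= t n} &
      forall p, G p -> exists n, p \in t n].
Proof.
move=> /countable_injP[f finj].
have /choice[c Hc] : forall n, exists c : seq I, forall p, (p \in c) <-> (G p /\ f p = n).
  move=> n; have [[p [Gp fp]]|nex] := pselect (exists p, G p /\ f p = n).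
    exists [:: p] => q; rewrite inE; split=> [/eqP->//|[Gq fq]].
    by apply/eqP; apply: finj; rewrite ?inE// fq fp.
  by exists [::] => q; split => // h; case: nex; exists q.
exists (fun n => undup (flatten [seq c i | i <- iota 0 n])); split.
- by move=> n; exact: undup_uniq.
- by move=> n p; rewrite mem_undup => /flatten_mapP[i _ /Hc[]].
- move=> m n mn p; rewrite !mem_undup => /flatten_mapP[i im pi].
  apply/flatten_mapP; exists i => //; move: im; rewrite !mem_iota !add0n /=.
  by move=> /leq_trans; exact.
move=> p Gp; exists (f p).+1; rewrite mem_undup; apply/flatten_mapP; exists (f p).
  by rewrite mem_iota add0n ltnSn.
by apply/Hc.
Qed.

Context {d : measure_display} {X : measurableType d} {R : realType}.
Variable mu : probability X R.

Lemma measurable_seq_bigcup (s : seq I) (U : I -> set X) :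
  (forall p, measurable (U p)) -> measurable (\bigcup_(p in [set p | p \in s]) U p).
Proof. by move=> mU; rewrite bigcup_seq; apply: bigsetU_measurable. Qed.

(** Passes from a countable cover to the finite families of [entropy_rate_le_blocks]; the retained
    part of [Z] is the set [F'] there. *)
Lemma countable_cover_truncation (G : set I) (U : I -> set X) (Z : set X) (rho : R) :
  countable G -> (forall p, measurable (U p)) -> measurable Z ->
  Z `<=` \bigcup_(p in G) U p -> 0 < rho ->
  exists t : seq I, [/\ uniq t, forall p, p \in t -> G p &
    pr mu Z - rho <= pr mu (Z `&` \bigcup_(p in [set p | p \in t]) U p)].
Proof.
move=> /countable_seq[t [ut tG tm Gt]] mU mZ ZU rho0.
pose F n := Z `&` \bigcup_(p in [set p | p \in t n]) U p.
have mF n : measurable (F n) by apply: measurableI => //; exact: measurable_seq_bigcup.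
have Fm m n : (m <= n)%N -> F m `<=` F n.
  by move=> mn x [Zx [p /= pm Up]]; split => //; exists p => //=; exact: tm pm.
have [n Hn] := pr_bigcup_nondecreasing mu rho0 mF Fm.
exists (t n); split => //; first exact: tG.
apply: le_trans (ltW Hn); rewrite lerD2r; apply: le_pr => //.
  exact: bigcupT_measurable.
move=> x Zx; have [p Gp Up] := ZU x Zx; have [k pk] := Gt p Gp.
by exists k => //; split => //; exists p.
Qed.

Lemma esum_seq_le (t : seq I) (G : set I) (f : I -> R) (c : \bar R) : uniq t ->
  (forall p, p \in t -> G p) ->
  (\esum_(p in G) (f p)%:E <= c)%E -> ((\sum_(p <- t) f p)%:E <= c)%E.
Proof.
move=> ut tG; apply: le_trans; apply: esum_ge; exists [set` t].
  by split; [exact: finite_seq|move=> p; exact: tG].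
by rewrite -sumEFin fsbig_seq.
Qed.

End CountableTruncation.

(** * Lower bound for the Caratheodory pressure *)

Section Dynamics.
Context {R : realType} {X : pointedType} {d : X -> X -> R}.
Local Notation B := (Borel d).
Variables (T : B -> B) (phi : nat -> B -> R) (mu : probability B R).
Hypotheses (dm : is_metric d) (dc : dcompact d) (cT : dcontinuous_map d T).
Hypothesis sphi : supadditive_potential d T phi.
Hypotheses (Tinv : T_invariant T mu) (Terg : T_ergodic T mu).

Let mT : measurable_fun setT T := dcontinuous_map_measurable cT.

(* The value at [0] of a potential is arbitrary; it is normalised to [0]. *)
Definition potential0 (n : nat) (x : B) : R := if n is 0 then 0 else phi n x.

Lemma potential0E n x : (0 < n)%N -> potential0 n x = phi n x. Proof. by case: n. Qed.

Lemma potential0_superadditive : superadditive T potential0.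
Proof.
case: sphi => _ sp; split=> // -[|n] [|m] x /=; rewrite ?addr0 ?add0r ?addn0//.
exact: (sp n.+1 m.+1).
Qed.

Lemma bounded_measurable_phi n : (0 < n)%N -> bounded_measurable (phi n).
Proof.
move=> n0; case: sphi => /(_ n n0) c _.
by split; [exact: dcontinuous_fun_measurable|exact: (continuous_bounded dm dc c)].
Qed.

Lemma bounded_measurable_potential0 n : bounded_measurable (potential0 n).
Proof. by case: n => [|n]; [exact: bounded_measurable_cst|exact: bounded_measurable_phi]. Qed.

Lemma measurable_bowen_ball n (x : B) eps : measurable (bowen_ball d T n x eps : set B).
Proof. by apply: dopen_measurable; exact: dopen_bowen_ball. Qed.

Lemma caraM_nondecreasing Z s eps m n : (m <= n)%N ->
  (caraM T phi Z s m eps <= caraM T phi Z s n eps)%E.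
Proof.
move=> mn; apply: ereal_inf_le_tmp => _ [G [cG nG ZG] <-]; exists G => //.
by split => // p /nG; exact: leq_trans.
Qed.

Lemma caramE Z s eps : caram T phi Z s eps = ereal_sup (range (fun N => caraM T phi Z s N eps)).
Proof.
apply/cvg_lim => //; apply: ereal_nondecreasing_cvgn => m n.
exact: caraM_nondecreasing.
Qed.

Lemma caraM_ge0 Z s N eps : (0 <= caraM T phi Z s N eps)%E.
Proof.
by apply: le_ereal_inf_tmp => _ [G _ <-]; apply: esum_ge0 => p _; rewrite lee_fin expR_ge0.
Qed.

Lemma caram_eq0P Z s eps :
  caram T phi Z s eps = 0%E <-> forall N, (caraM T phi Z s N eps <= 0)%E.
Proof.
rewrite caramE; split=> [<- N|h].
  by apply: ereal_sup_ubound; exists N.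
apply/eqP; rewrite eq_le; apply/andP; split.
  by apply: ge_ereal_sup => _ [N _ <-].
by apply: le_trans (caraM_ge0 Z s 0 eps) _; apply: ereal_sup_ubound; exists 0%N.
Qed.

(* Replacing the cells of a partition by disjoint closed subsets (which lie at positive
   distance of each other) dispenses with partitions whose boundary is negligible. *)
Lemma closed_kernel (A : finType) (code : B -> A) (e : R) :
  (forall a, measurable (code @^-1` [set a])) -> 0 < e ->
  exists K : A -> set B, [/\ forall a, dopen d (~` K a), forall a x, K a x -> code x = a &
    pr mu (~` \bigcup_(a in [set: A]) K a) <= e].
Proof.
move=> mcode e0; have A0 : (0 < #|A|)%N by apply/card_gt0P; exists (code point).
have cA : 0 < #|A|%:R :> R by rewrite ltr0n.
have /choice[K HK] : forall a, exists K : set B,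
    [/\ dopen d (~` K), K `<=` code @^-1` [set a] & pr mu (code @^-1` [set a] `\` K) <= e / #|A|%:R].
  move=> a; have [K [U [cK oU KA AU UK]]] :=
    measurable_regular dm mu (mcode a) (divr_gt0 e0 cA).
  exists K; split => //; apply: le_trans (ltW UK); apply: le_pr.
  - by apply: measurableD => //; exact: dclosed_measurable.
  - by apply: measurableD; [exact: dopen_measurable|exact: dclosed_measurable].
  - by move=> x [/AU].
have cK a : dopen d (~` K a) by have [] := HK a.
have mK a : measurable (K a) by exact: dclosed_measurable.
exists K; split => //; first by move=> a x; have [_ h _] := HK a; move=> /h.
have mU : measurable (\bigcup_(a in [set: A]) K a).
  by apply: fin_bigcup_measurable => //; exact: finite_finset.
pose D a := code @^-1` [set a] `\` K a.
have mD a : measurable (D a) by exact: measurableD.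
have sub (s : seq A) : pr mu (\big[setU/set0]_(a <- s) D a) <= (size s)%:R * (e / #|A|%:R).
  elim: s => [|a s IH]; first by rewrite big_nil pr_set0 mul0r.
  rewrite big_cons (le_trans (prU mu (mD a) (bigsetU_measurable _ _)))//.
  by rewrite /= mulrSr mulrDl mul1r addrC lerD//; have [] := HK a.
have := sub (enum A); rewrite -cardE mulrC divfK ?gt_eqF//; apply: le_trans.
apply: le_pr; first exact: measurableC.
  exact: bigsetU_measurable.
move=> x nK; rewrite -bigcup_seq; exists (code x); first by rewrite /= mem_enum.
by split => // Kx; apply: nK; exists (code x).
Qed.

(** [entropy_rate_le_blocks] is applied with [psi = phi k / k] and the weights
    [exp (- s m + phi m x)] of a cover of [Z]; a ball predicts the code at all times spent in closed
    kernels of the cells. The threshold [eps0] is chosen before [Z] and [s], hence serves them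
    all. *)
Lemma partition_caratheodory_ge (xi : seq (set B)) (k : nat) (a : R) :
  meas_partition xi -> (0 < k)%N ->
  a < part_entropy T mu xi + k%:R^-1 * mean mu (phi k) ->
  exists2 eps0 : R, 0 < eps0 & forall eps, 0 < eps < eps0 ->
    forall (Z : set B) (s : R), measurable Z -> 0 < pr mu Z ->
      caram T phi Z s eps = 0%E -> a <= s.
Proof.
move=> pxi k0 ha; have [code codeP] := partition_code pxi.
rewrite (part_entropyE T mu codeP) in ha.
have mcode := measurable_code pxi codeP.
set h := entropy_rate mu T code in ha.
pose psi x := k%:R^-1 * phi k x.
have k0R : 0 < k%:R :> R by rewrite ltr0n.
have bpsi : bounded_measurable psi.
  by apply: bounded_measurableZ; exact: bounded_measurable_phi.
have mpsi : mean mu psi = k%:R^-1 * mean mu (phi k).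
  by rewrite meanZ//; exact: bounded_measurable_phi.
rewrite -mpsi in ha.
(* At most five of the six [tau] are spent: one each on the variation of [phi k] in a ball, the
   constant [b], the tiling, the noise and the complement of the kernels. *)
have [tau tau0 tauE] : exists2 tau : R, 0 < tau & h + mean mu psi - a = 6 * tau.
  by exists ((h + mean mu psi - a) / 6); [rewrite divr_gt0// subr_gt0|field].
pose kappa := 1 - expR (- tau).
have kappa01 : 0 < kappa < 1.
  rewrite /kappa subr_gt0 -expR0 ltr_expR oppr_lt0 tau0/= expR0.
  by have := expR_gt0 (- tau); lra.
have lnk : ln (1 - kappa) = - tau.
  by rewrite (_ : 1 - kappa = expR (- tau)) ?expRK// /kappa; ring.
have A0 : (0 < #|'I_(size xi)|)%N by apply/card_gt0P; exists (code point).
set Mc := ln (#|'I_(size xi)|%:R / kappa).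
have Mc0 : 0 <= Mc.
  case/andP: kappa01 => k1 k2; apply: ln_ge0; rewrite ler_pdivlMr// mul1r.
  by rewrite (le_trans (ltW k2))// ler1n.
(* [Mc] is fixed before the kernels, whose complement can thus be made small against it. *)
have e0 : 0 < tau / (Mc + 1) by rewrite divr_gt0//; lra.
have [K [cK Kcode prK]] := closed_kernel mcode e0.
have MK : Mc * pr mu (~` \bigcup_(l in [set: 'I_(size xi)]) K l) <= tau.
  have -> : tau = (Mc + 1) * (tau / (Mc + 1)) by rewrite mulrC divfK// gt_eqF//; lra.
  by apply: ler_pM => //; [exact: pr_ge0|lra].
have mK : measurable (\bigcup_(l in [set: 'I_(size xi)]) K l).
  apply: fin_bigcup_measurable; first exact: finite_finset.
  by move=> l _; exact: dclosed_measurable.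
have Kdis l l' x : K l x -> K l' x -> l = l' by move=> /Kcode <- /Kcode <-.
have [e1 e10 He1] := closed_separation dm dc cK Kdis.
have cphi : dcontinuous_fun d (phi k) by case: sphi => /(_ k k0).
have [e2 e20 He2] := uniform_continuity dm dc cphi (mulr_gt0 k0R tau0).
(* Half of [e1], because two points of one ball of radius [eps] are compared with each other. *)
exists (Num.min (e1 / 2) e2); first by rewrite lt_min e20 divr_gt0.
move=> eps /andP[eps0]; rewrite lt_min => /andP[eps1 eps2] Z s mZ Z0 /caram_eq0P hM.
(* A ball of radius [eps] meets at most one kernel, whose label is predicted; if it meets none, the
   prediction is arbitrary. *)
have /choice[pred Hpred] : forall x : B, exists l : 'I_(size xi),
    forall l' y, K l' y -> d x y < eps -> l' = l.
  move=> x; have [[l [y [Ky xy]]]|nex] := pselect (exists l y, K l y /\ d x y < eps).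
    exists l => l' y' Ky' xy'; apply: (He1 _ _ y' y) => //.
    by have := dist_triangle dm x y' y; rewrite (dist_sym dm y' x); lra.
  by exists (code point) => l' y Ky xy; case: nex; exists l', y.
have [N0 [rho rho0 H]] := entropy_rate_le_blocks mT Tinv Terg mcode pred kappa01
  (s + 2 * tau) bpsi mK mZ Z0 tau0.
have [C phiC] : exists C : R, forall x, `|phi 1%N x| <= C.
  by case: (bounded_measurable_phi (ltnSn 0)).
have [D phiD] : exists D : R, forall x, `|phi k x| <= D.
  by case: (bounded_measurable_phi k0).
have p1 x : - C <= potential0 1 x by exact: lerNnormlW (phiC x).
have pk x : potential0 k x <= D by rewrite potential0E// (le_trans (ler_norm _)).
have [b Hb] := superadditive_ge_birkhoff potential0_superadditive p1 k0 pk.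
(* For balls of length at least [N] the additive constant [b] costs at most [tau] per step. *)
pose N := maxn N0 (Num.truncn (b / (k%:R * tau))).+1.
have bN n : (N <= n)%N -> b <= n%:R * (k%:R * tau).
  rewrite geq_max => /andP[_ hn]; rewrite -ler_pdivrMr ?mulr_gt0//.
  by rewrite ltW// (lt_le_trans (truncnS_gt _))// ler_nat.
have [G [cG nG ZG] sG] : exists2 G, cara_cover T Z N eps G &
    (\esum_(p in G) (expR (- (s * p.2%:R) + phi p.2 p.1))%:E <= (1 / 2)%:E)%E.
  (* The other half of the total weight is left to single letters. *)
  have : (caraM T phi Z s N eps < (1 / 2)%:E)%E.
    by apply: le_lt_trans (hM N) _; rewrite lte_fin divr_gt0.
  by move=> /ereal_inf_lt[_ [G cG <-] /ltW ?]; exists G.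
have [t [ut tG prt]] := countable_cover_truncation mu cG
  (fun p => measurable_bowen_ball p.2 p.1 eps) mZ ZG rho0.
have st := esum_seq_le ut tG sG; rewrite lee_fin in st.
have := H t (fun p => expR (- (s * p.2%:R) + phi p.2 p.1)) _ (\max_(p <- t) p.2)%N
  (measurableI _ _ mZ (measurable_seq_bigcup t (fun p => measurable_bowen_ball p.2 p.1 eps)))
  (@subIsetl _ _ _) prt (fun p => expR_gt0 _) st.
rewrite lnk -/Mc => Hc; suff : h <= s + 2 * tau + tau - mean mu psi + tau + tau.
  by lra.
apply: le_trans (Hc _) _; last by lra.
move=> y [Zy [p /= pt yp]]; exists p => //.
have Np := nG _ (tG _ pt); have bp := bN _ Np.
split.
- rewrite (leq_trans (leq_maxl _ _) Np)/=.
  by rewrite (perm_big _ (perm_to_rem pt))/= big_cons leq_maxl.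
- rewrite expRK.
  have p20 : (0 < p.2)%N by apply: leq_trans Np; rewrite /N leq_max ltn0Sn orbT.
  have := Hb p.2 p.1; rewrite potential0E// => hb.
  have : birkhoff_sum T psi p.2 y <=
         k%:R^-1 * birkhoff_sum T (potential0 k) p.2 p.1 + p.2%:R * tau.
    rewrite /birkhoff_sum mulr_sumr -[p.2%:R]/(p.2%:R) -[X in X%:R * tau](card_ord p.2).
    rewrite mulr_natl -sumr_const -big_split/=; apply: ler_sum => j _.
    have := He2 _ _ (lt_trans (yp j (ltn_ord j)) eps2).
    rewrite potential0E// /psi => hh.
    rewrite -lerBlDl -mulrBr ler_pdivrMl//; apply: le_trans (ltW hh).
    by rewrite distrC ler_norm.
  have : k%:R^-1 * (birkhoff_sum T (potential0 k) p.2 p.1 - b) <= phi p.2 p.1.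
    by rewrite ler_pdivrMl.
  have : k%:R^-1 * b <= p.2%:R * tau by rewrite ler_pdivrMl// mulrCA.
  lra.
move=> j jp [l _ Kl]; rewrite (Kcode _ _ Kl); apply: (Hpred _ _ (iter j T y)) => //.
exact: yp.
Qed.

(** Comes from the trivial partition; it excludes [-oo + +oo], so that a real upper bound on the sum
    of entropy and [Phi_star] keeps [Phi_star] below [+oo]. *)
Lemma ms_entropy_ge0 : (0 <= ms_entropy T mu)%E.
Proof.
pose xi : seq (set B) := [:: setT].
have pxi : meas_partition xi.
  split.
  - by move=> A; rewrite inE => /eqP->.
  - by move=> i j /andP[ij]; rewrite ltnS leqn0 => /eqP j0; rewrite j0 in ij.
  - by move=> x; exists setT => //; rewrite inE.
have [code codeP] := partition_code pxi; have mcode := measurable_code pxi codeP.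
apply: (@le_trans _ _ (part_entropy T mu xi)%:E); last first.
  by apply: ereal_sup_ubound; exists xi.
rewrite lee_fin (part_entropyE T mu codeP); apply: limr_ge.
  apply: (fekete_cvgn (word_entropy_ge0 mu mT mcode) (word_entropyD mT Tinv mcode)).
by near=> n; rewrite divr_ge0// word_entropy_ge0.
Unshelve. all: by end_near. Qed.

Lemma Phi_starE : Phi_star mu phi =
  ereal_sup [set (n%:R^-1 * mean mu (phi n))%:E | n in [set n | (1 <= n)%N]].
Proof.
congr ereal_sup; apply/seteqP; split => _ [n /= n1 <-]; exists n => //.
  by rewrite meanE//; exact: bounded_measurable_phi.
by rewrite meanE//; exact: bounded_measurable_phi.
Qed.

(** A real [a] below the sum is already below the contribution of one partition and one index
    [k]. *)
Lemma caratheodory_ge (a : R) : (a%:E < ms_entropy T mu + Phi_star mu phi)%E ->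
  exists2 eps0 : R, 0 < eps0 & forall eps, 0 < eps < eps0 ->
    forall (Z : set B) (s : R), measurable Z -> 0 < pr mu Z ->
      caram T phi Z s eps = 0%E -> a <= s.
Proof.
rewrite Phi_starE => /lt_ereal_supD[||xi [k [pxi k1 ha]]].
- exists [:: setT]; split.
  - by move=> A; rewrite inE => /eqP->.
  - by move=> i j /andP[ij]; rewrite ltnS leqn0 => /eqP j0; rewrite j0 in ij.
  - by move=> x; exists setT => //; rewrite inE.
- by exists 1%N.
exact: partition_caratheodory_ge pxi k1 ha.
Qed.

End Dynamics.

(** * Upper bound: spanning sets of small cost *)

Section UpperBound.
Context {R : realType} {X : pointedType} {d : X -> X -> R}.
Local Notation B := (Borel d).
Variables (T : B -> B) (phi : nat -> B -> R) (mu : probability B R).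
Hypotheses (dm : is_metric d) (dc : dcompact d) (cT : dcontinuous_map d T).
Hypothesis sphi : supadditive_potential d T phi.
Hypotheses (Tinv : T_invariant T mu) (Terg : T_ergodic T mu).

Let mT : measurable_fun setT T := dcontinuous_map_measurable cT.

(** From each ball of a finite cover the earlier balls are removed. *)
Lemma small_partition (e : R) : 0 < e -> exists2 xi : seq (set B), meas_partition xi &
  forall i x y, nth set0 xi i x -> nth set0 xi i y -> d x y < e.
Proof.
move=> e0; have e20 : 0 < e / 2 by rewrite divr_gt0.
have [s Hs] := finite_ball_cover dm dc (fun=> e20).
pose b j : set B := [set y | d (nth point s j) y < e / 2].
pose C i : set B := b i `&` \bigcap_(j in [set j | (j < i)%N]) ~` b j.
have mb j : measurable (b j) by apply: dopen_measurable; exact: dopen_ball.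
have mC i : measurable (C i).
  apply: measurableI => //; rewrite -setC_bigcup; apply: measurableC.
  exact: bigcup_measurable.
exists (mkseq C (size s)); first split.
- by move=> A /mapP[i _ ->].
- move=> i j /andP[ij]; rewrite size_mkseq => js.
  rewrite !nth_mkseq//; last exact: ltn_trans js.
  by rewrite -subset0 => x [[bi _] [_ /(_ i ij)]].
- move=> x; pose i := find (fun c => d c x < e / 2) s.
  have hs : has (fun c => d c x < e / 2) s by apply/hasP; exact: Hs.
  have si : (i < size s)%N by rewrite -has_find.
  exists (C i); first by apply/mapP; exists i => //; rewrite mem_iota add0n si.
  split; first exact: (nth_find point hs).
  by move=> j /= ji; apply/negP; rewrite (before_find point ji).
move=> i x y; have [si|si] := ltnP i (size s); last by rewrite nth_default ?size_mkseq.
rewrite nth_mkseq// => -[/= ix _] [/= iy _].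
apply: le_lt_trans (dist_triangle dm (nth point s i) x y) _.
by rewrite (dist_sym dm x) [ltRHS]splitr; exact: ltrD.
Qed.

(** One centre is chosen for each itinerary realised in [Z]: points with equal itineraries stay
    [eps]-close, the cells being small. At the centre for [w], [expR (phi n x)] is at most
    [V w * expR (n b)], and the weights [V w] sum to at most 1. The set [Z] does not vary with
    [n]. *)
Lemma spanning_le (b eps del : R) : (ms_entropy T mu + Phi_star mu phi < b%:E)%E ->
  0 < eps -> 0 < del ->
  exists (Z : set B) (N : nat), [/\ measurable Z, 1 - del <= pr mu Z &
    forall n, (N <= n)%N -> exists2 F : seq B,
      Z `<=` \bigcup_(x in [set x | x \in F]) bowen_ball d T n x eps &
      \sum_(x <- F) expR (phi n x) <= expR (n%:R * b)].
Proof.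
move=> hb eps0 del0; have [xi pxi dxi] := small_partition eps0.
have [code codeP] := partition_code pxi; have mcode := measurable_code pxi codeP.
pose h := entropy_rate mu T code.
have hle : (h%:E <= ms_entropy T mu)%E.
  by apply: ereal_sup_ubound; exists xi => //; rewrite (part_entropyE T mu codeP).
have Phi1 n : (0 < n)%N -> ((n%:R^-1 * mean mu (phi n))%:E <= Phi_star mu phi)%E.
  by move=> n0; rewrite (Phi_starE mu dm dc sphi); apply: ereal_sup_ubound; exists n.
have [P PE] : exists P : R, Phi_star mu phi = P%:E.
  move: hb; have := Phi1 1%N isT; case: (Phi_star mu phi) => [P| |] //; first by exists P.
  have := ms_entropy_ge0 cT Tinv; case: (ms_entropy T mu) => [u| |] //.
have hPb : h + P < b.
  rewrite -lte_fin EFinD; apply: le_lt_trans hb; rewrite PE; exact: leeD2r.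
have mphi n : mean mu (potential0 phi n) <= n%:R * P.
  case: n => [|n]; first by rewrite mul0r /potential0 mean_cst.
  have := Phi1 n.+1 isT; rewrite PE lee_fin ler_pdivrMl//.
(* One [eta] goes to the bound on [phi n], the other to the bound on [V]. *)
have [eta eta0 etaE] : exists2 eta : R, 0 < eta & b = h + P + 2 * eta.
  by exists ((b - h - P) / 2); [rewrite divr_gt0//; lra|field].
have del20 : 0 < del / 2 by rewrite divr_gt0.
have [Z1 [mZ1 prZ1] [N1 HZ1]] := superadditive_eventually_lt mT Tinv Terg
  (potential0_superadditive sphi) (bounded_measurable_potential0 dm dc sphi) mphi eta0 del20.
have [V [Z2 [N2 [V0 V1 mZ2 prZ2 HZ2]]]] :=
  itinerary_weight mT Tinv Terg mcode eta0 del20.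
exists (Z1 `&` Z2), (maxn 1 (maxn N1 N2)); split; first exact: measurableI.
  have := prDI mu mZ1 mZ2; have := le_pr mu (measurableD mZ1 mZ2) (measurableC mZ2) (@subDsetr _ _ _).
  by rewrite prC//; lra.
move=> n; rewrite !geq_max => /and3P[n0 N1n N2n].
pose real w := exists2 x, (Z1 `&` Z2) x & itinerary T code n x = w.
have /choice[g Hg] : forall w, exists x, real w -> (Z1 `&` Z2) x /\ itinerary T code n x = w.
  move=> w; have [[x Zx xw]|nr] := pselect (real w); first by exists x.
  by exists point => /nr.
exists [seq g w | w <- words n & `[< real w >]].
  move=> x Zx; have rx : real (itinerary T code n x) by exists x.
  have [Zg gx] := Hg _ rx.
  exists (g (itinerary T code n x)).
    apply: map_f; rewrite mem_filter mem_words size_itinerary eqxx andbT.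
    exact/asboolP.
  move=> i ni; set c := code (iter i T x).
  have ci : code (iter i T (g (itinerary T code n x))) = c.
    by rewrite -(nth_itinerary T code c _ ni) gx nth_itinerary.
  by apply: (dxi c); apply/codeP.
rewrite big_map big_filter.
apply: (@le_trans _ _ (\sum_(w <- words n | `[< real w >]) V w * expR (n%:R * b))).
  rewrite big_seq_cond [leRHS]big_seq_cond; apply: ler_sum => w /andP[_ /asboolP rw].
  have [[Z1g Z2g] gw] := Hg w rw.
  have := HZ1 _ _ Z1g N1n; rewrite potential0E// => h1.
  have := HZ2 _ _ Z2g N2n; rewrite gw -/h => h2.
  apply: le_trans (ler_wpM2r (expR_ge0 _) h2); rewrite -expRD ler_expR etaE; lra.
rewrite -mulr_suml ler_piMl ?expR_ge0//; apply: le_trans (V1 n).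
by rewrite big_mkcond/=; apply: ler_sum => w _; case: ifP.
Qed.

End UpperBound.

(** * The four pressures *)

Section OneSidedLimits.
Context {R : realType}.
Implicit Types (f : R -> \bar R) (u : nat -> \bar R).

Lemma near_right0 (P : R -> Prop) (e0 : R) : 0 < e0 ->
  (forall e, 0 < e < e0 -> P e) -> \forall e \near 0^'+, P e.
Proof.
move=> e00 h; near=> e; apply: h; apply/andP; split; first by near: e; exact: nbhs_right_gt.
by near: e; exact: nbhs_right_lt.
Unshelve. all: by end_near. Qed.

Lemma eliminf0_le f (b : \bar R) (e0 : R) : 0 < e0 ->
  (forall e, 0 < e < e0 -> (f e <= b)%E) -> (eliminf0 f <= b)%E.
Proof.
move=> e00 h; rewrite /eliminf0 limf_einfE; apply: ge_ereal_sup => _ [V FV <-].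
have [e [Ve fe]] : exists e, V e /\ (f e <= b)%E.
  have : \forall e \near 0^'+, V e /\ (f e <= b)%E.
    by apply: filterI => //; exact: near_right0 h.
  by move=> /filter_ex[e ?]; exists e.
by apply: le_trans fe; apply: ereal_inf_lbound; exists e.
Qed.

Lemma eliminf0_ge f (a : \bar R) (e0 : R) : 0 < e0 ->
  (forall e, 0 < e < e0 -> (a <= f e)%E) -> (a <= eliminf0 f)%E.
Proof.
move=> e00 h; rewrite /eliminf0 limf_einfE.
apply: (@le_trans _ _ (ereal_inf (f @` [set e | 0 < e < e0]))).
  by apply: le_ereal_inf_tmp => _ [e /h ? <-].
by apply: ereal_sup_ubound; exists [set e | 0 < e < e0] => //; exact: (near_right0 e00).
Qed.

(** Monotonicity guarantees that the limits in [elim0] exist, so that bounds pass to them. *)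
Definition antitone_pos f := forall e e', 0 < e -> e <= e' -> (f e' <= f e)%E.

Lemma antitone_pos_cvg f : antitone_pos f -> cvg (f @ 0^'+).
Proof.
move=> af; apply: nonincreasing_at_right_is_cvge; near=> x => y z.
by rewrite !in_itv/= => /andP[y0 _] /andP[z0 _] yz; exact: af.
Unshelve. all: by end_near. Qed.

Lemma elim0_le f (b : \bar R) (e0 : R) : antitone_pos f -> 0 < e0 ->
  (forall e, 0 < e < e0 -> (f e <= b)%E) -> (elim0 f <= b)%E.
Proof.
move=> af e00 h; apply: lime_le; first exact: antitone_pos_cvg.
exact: near_right0 h.
Qed.

Lemma elim0_ge f (a : \bar R) (e0 : R) : antitone_pos f -> 0 < e0 ->
  (forall e, 0 < e < e0 -> (a <= f e)%E) -> (a <= elim0 f)%E.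
Proof.
move=> af e00 h; apply: lime_ge; first exact: antitone_pos_cvg.
exact: near_right0 h.
Qed.

Lemma le_elim0 f g : antitone_pos f -> antitone_pos g ->
  (forall e, 0 < e -> (f e <= g e)%E) -> (elim0 f <= elim0 g)%E.
Proof.
move=> af ag fg; apply: lee_lim; [exact: antitone_pos_cvg|exact: antitone_pos_cvg|].
by apply: (near_right0 ltr01) => e /andP[e0 _]; exact: fg.
Qed.

Lemma limn_esup_le u (b : \bar R) N : (forall n, (N <= n)%N -> (u n <= b)%E) ->
  (limn_esup u <= b)%E.
Proof.
move=> h; rewrite /limn_esup limf_esupE.
apply: (@le_trans _ _ (ereal_sup (u @` [set n | (N <= n)%N]))).
  by apply: ereal_inf_lbound; exists [set n | (N <= n)%N] => //; exists N.
by apply: ge_ereal_sup => _ [n /h ? <-].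
Qed.

Lemma limn_esup_lt u (b : \bar R) : (limn_esup u < b)%E ->
  exists N, forall n, (N <= n)%N -> (u n < b)%E.
Proof.
rewrite /limn_esup limf_esupE => /ereal_inf_lt[_ [V [N _ NV] <-] Vb].
exists N => n Nn; apply: le_lt_trans Vb; apply: ereal_sup_ubound; exists n => //.
exact: NV.
Qed.

Lemma limn_einf_lt u (b : \bar R) : (limn_einf u < b)%E ->
  forall N, exists2 n, (N <= n)%N & (u n < b)%E.
Proof.
rewrite -[limn_einf u]/(limf_einf u \oo) limf_einfE => h N.
have : (ereal_inf (u @` [set n | (N <= n)%N]) < b)%E.
  apply: le_lt_trans h; apply: ereal_sup_ubound.
  by exists [set n | (N <= n)%N] => //; exists N.
by move=> /ereal_inf_lt[_ [n Nn <-] ub]; exists n.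
Qed.

Lemma le_limn_esup u v : (forall n, (u n <= v n)%E) -> (limn_esup u <= limn_esup v)%E.
Proof.
move=> uv; rewrite leNgt; apply/negP => /lte_exists_real[r /andP[vr ru]].
have [N HN] := limn_esup_lt vr.
suff : (limn_esup u <= r%:E)%E by move=> /(lt_le_trans ru); rewrite ltxx.
apply: (@limn_esup_le _ _ N) => n /HN /ltW; exact: le_trans.
Qed.

Lemma le_elog (x y : \bar R) : (x <= y)%E -> (elog x <= elog y)%E.
Proof.
case: x y => [x| |] [y| |]//=; rewrite ?leey ?leNye// ?lee_fin => xy.
  case: ifPn => x0; case: ifPn => y0; rewrite ?leNye// ?lee_fin.
    by rewrite ler_ln ?posrE.
  by rewrite (lt_le_trans x0 xy) in y0.
Qed.

Lemma elog_le (n : nat) (x : \bar R) (b : R) : (0 < n)%N ->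
  (x <= (expR (n%:R * b))%:E)%E -> ((n%:R^-1)%:E * elog x <= b%:E)%E.
Proof.
move=> n0 /le_elog; rewrite /= expR_gt0 expRK => h.
have n0R : 0 < n%:R^-1 :> R by rewrite invr_gt0 ltr0n.
have := lee_wpmul2l (ltW n0R : (0%:E <= (n%:R^-1)%:E)%E) h.
by rewrite -EFinM mulKf// pnatr_eq0 -lt0n.
Qed.

Lemma elog_lt (n : nat) (x : \bar R) (r : R) : (0 < n)%N ->
  ((n%:R^-1)%:E * elog x < r%:E)%E -> (x < (expR (n%:R * r))%:E)%E.
Proof.
move=> n0; have n0R : 0 < n%:R :> R by rewrite ltr0n.
have n0V : 0 < n%:R^-1 :> R by rewrite invr_gt0.
case: x => [x| |] /=; last 2 first.
- by rewrite gt0_muley ?lte_fin// ltNge leey.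
- by rewrite ltNyr.
case: ifPn => [x0|]; last by rewrite -leNgt => x0 _; rewrite lte_fin (le_lt_trans x0)// expR_gt0.
rewrite -EFinM !lte_fin -ltr_pdivlMl ?invr_gt0// invrK => h.
by rewrite -[ltLHS]lnK ?posrE// ltr_expR.
Qed.

Lemma expRN_le (q e : R) (N : nat) : 0 < q -> 0 < e ->
  exists2 n, (N <= n)%N & forall m, (n <= m)%N -> expR (- (m%:R * q)) <= e.
Proof.
move=> q0 e0; exists (maxn N (Num.truncn (- ln e / q)).+1); first exact: leq_maxl.
move=> m; rewrite geq_max => /andP[_ hm].
rewrite -[leRHS]lnK ?posrE// ler_expR lerNl -ler_pdivrMr//.
by rewrite ltW// (lt_le_trans (truncnS_gt _))// ler_nat.
Qed.

End OneSidedLimits.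

(** * Sums over countable unions of finite families *)

Section FiniteSums.
Context {R : realType} {I : choiceType}.
Variable w : I -> R.
Hypothesis w0 : forall p, 0 <= w p.

Lemma ler_sum_subseq (s t : seq I) : uniq s -> {subset s <= t} ->
  \sum_(p <- s) w p <= \sum_(p <- t) w p.
Proof.
elim: s t => [|p s IH] t; first by rewrite big_nil sumr_ge0.
move=> /= /andP[ps us] st; have pt : p \in t by apply: st; rewrite inE eqxx.
rewrite big_cons (perm_big _ (perm_to_rem pt))/= big_cons lerD2l; apply: IH => // q qs.
apply: rem_mem; last by apply: st; rewrite inE qs orbT.
by apply: contraNneq ps => <-.
Qed.

Lemma esum_le_seq (G : set I) (c : R) :
  (forall t, uniq t -> (forall p, p \in t -> G p) -> \sum_(p <- t) w p <= c) ->
  (\esum_(p in G) (w p)%:E <= c%:E)%E.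
Proof.
move=> h; apply: ge_ereal_sup => _ [A [fA AG] <-].
rewrite fsbig_finite// sumEFin lee_fin; apply: h; first exact: finmap.fset_uniq.
by move=> p; rewrite in_fset_set// inE; exact: AG.
Qed.

(** A finite part of the union lies in finitely many [L k]; repeated elements only increase the sum,
    which a geometric series bounds. *)
Lemma esum_bigcup_seq_le (L : nat -> seq I) (e : R) : 0 <= e ->
  (forall k, \sum_(p <- L k) w p <= e / 2 ^+ k.+1) ->
  (\esum_(p in \bigcup_k [set p | p \in L k]) (w p)%:E <= e%:E)%E.
Proof.
move=> e0 hL; apply: esum_le_seq => t ut tG.
have [K HK] : exists K, {subset t <= flatten [seq L k | k <- iota 0 K]}.
  elim: t {ut} tG => [|p t IH] tG; first by exists 0%N.
  have [K HK] := IH (fun q qt => tG q (mem_behead (s := p :: t) qt)).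
  have [k _ /= pk] := tG p (mem_head _ _).
  exists (maxn K k.+1) => q; rewrite inE => /predU1P[->|/HK /flatten_mapP[j jK qj]].
    by apply/flatten_mapP; exists k => //; rewrite mem_iota add0n leq_max ltnSn orbT.
  apply/flatten_mapP; exists j => //; move: jK; rewrite !mem_iota !add0n/= => jK.
  by rewrite leq_max jK.
apply: le_trans (ler_sum_subseq ut HK) _; rewrite big_flatten/= big_map.
have : \sum_(k <- iota 0 K) \sum_(p <- L k) w p <= e - e / 2 ^+ K.
  elim: (K) => [|k IH]; first by rewrite big_nil expr0 divr1 subrr.
  rewrite -[k.+1]addn1 iotaD big_cat/= big_seq1 add0n.
  by have := hL k; rewrite addn1 exprS invfM; lra.
have : 0 <= e / 2 ^+ K by rewrite divr_ge0// exprn_ge0.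
lra.
Qed.

End FiniteSums.

(** * Each pressure equals entropy plus [Phi_star] *)

Section Pressures.
Context {R : realType} {X : pointedType} {d : X -> X -> R}.
Local Notation B := (Borel d).
Variables (T : B -> B) (phi : nat -> B -> R) (mu : probability B R).
Hypotheses (dm : is_metric d) (dc : dcompact d) (cT : dcontinuous_map d T).
Hypothesis sphi : supadditive_potential d T phi.
Hypotheses (Tinv : T_invariant T mu) (Terg : T_ergodic T mu).
Local Notation S := (ms_entropy T mu + Phi_star mu phi)%E.

Let cost (s : R) (p : B * nat) : R := expR (- (s * p.2%:R) + phi p.2 p.1).

Lemma caram_eq0 (Z : set B) (s eps : R) :
  (forall N e, 0 < e -> exists2 G, cara_cover T Z N eps G &
    (\esum_(p in G) (expR (- (s * p.2%:R) + phi p.2 p.1))%:E <= e%:E)%E) ->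
  caram T phi Z s eps = 0%E.
Proof.
move=> h; apply/caram_eq0P => N; apply/lee_addgt0Pr => e e0; rewrite add0e.
have [G cG] := h N e e0; apply: le_trans; apply: ereal_inf_lbound.
by exists G.
Qed.

Lemma bowen_ball_le n (x : B) (e e' : R) : e <= e' ->
  bowen_ball d T n x e `<=` bowen_ball d T n x e'.
Proof. by move=> ee' y h i /h; move/lt_le_trans; apply. Qed.

Lemma sum_cost (s : R) (F : seq B) (n : nat) :
  \sum_(p <- [seq (x, n) | x <- F]) cost s p =
  expR (- (n%:R * s)) * \sum_(x <- F) expR (phi n x).
Proof.
rewrite big_map mulr_sumr; apply: eq_bigr => x _.
by rewrite /cost/= mulrC expRD.
Qed.

Lemma le_pr_cover (Z : set B) (F : seq B) n eps : measurable Z ->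
  Z `<=` \bigcup_(x in [set x | x \in F]) bowen_ball d T n x eps ->
  pr mu Z <= pr mu (\bigcup_(x in [set x | x \in F]) bowen_ball d T n x eps : set B).
Proof.
move=> mZ ZF; apply: le_pr => //; apply: measurable_seq_bigcup => x.
exact: measurable_bowen_ball.
Qed.

(** Sets [Z k] of measure at least [1 - 1 / (k + 1)] have a union of full measure. Each has covers
    of cost at most [exp (n r)] with [r < b], so at exponent [b] a large [n] brings its cost below
    [e / 2^(k+1)]; this [n] may depend on [k], since the balls of a Caratheodory cover may have
    different lengths. *)
Lemma cara_pressure_eps_le (b eps : R) : (S < b%:E)%E -> 0 < eps ->
  (cara_pressure_eps T mu phi eps <= b%:E)%E.
Proof.
move=> /lte_exists_real[r /andP[Sr]]; rewrite lte_fin => rb eps0.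
have /choice[Z HZ] : forall k : nat, exists Z : set B, exists N : nat,
    [/\ measurable Z, 1 - k.+1%:R^-1 <= pr mu Z &
    forall n, (N <= n)%N -> exists2 F : seq B,
      Z `<=` \bigcup_(x in [set x | x \in F]) bowen_ball d T n x eps &
      \sum_(x <- F) expR (phi n x) <= expR (n%:R * r)].
  by move=> k; apply: spanning_le => //; rewrite invr_gt0.
have mZ k : measurable (Z k) by have [N []] := HZ k.
have mU : measurable (\bigcup_k Z k) by exact: bigcupT_measurable.
apply: (@le_trans _ _ (cara_PZ_eps T phi (\bigcup_k Z k) eps)).
  apply: ereal_inf_lbound; exists (\bigcup_k Z k) => //; split => //.
  rewrite prE//; congr EFin; apply/eqP; rewrite eq_le pr_le1//=.
  apply/ler_addgt0Pr => e e0; rewrite -lerBlDr.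
  have [_ [_ h _]] := HZ (Num.truncn e^-1).
  apply: (@le_trans _ _ (pr mu (Z (Num.truncn e^-1)))); last first.
    by apply: le_pr => //; exact: bigcup_sup.
  apply: le_trans h; rewrite lerD2l lerN2 -[leRHS]invrK lef_pV2 ?posrE ?invr_gt0//.
  by rewrite ltW// truncnS_gt.
apply: ereal_inf_lbound; exists b => //=; apply: caram_eq0 => N e e0.
have br : 0 < b - r by rewrite subr_gt0.
have /choice[L HL] : forall k, exists L : seq (B * nat),
    [/\ forall p, p \in L -> (N <= p.2)%N,
        Z k `<=` \bigcup_(p in [set p | p \in L]) bowen_ball d T p.2 p.1 eps &
        \sum_(p <- L) cost b p <= e / 2 ^+ k.+1].
  move=> k; have [Nk [_ _ h]] := HZ k.
  have [n nN hn] := expRN_le (maxn N Nk) br (divr_gt0 e0 (exprn_gt0 k.+1 (ltr0Sn R 1))).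
  have [F ZF sF] := h n (leq_trans (leq_maxr _ _) nN).
  exists [seq (x, n) | x <- F]; split.
  - by move=> _ /mapP[x _ ->]; exact: leq_trans (leq_maxl _ _) nN.
  - by move=> y /ZF[x /= xF xy]; exists (x, n) => //=; exact: map_f.
  rewrite sum_cost; apply: le_trans (ler_wpM2l (expR_ge0 _) sF) _.
  apply: le_trans (hn n (leqnn n)); rewrite -expRD ler_expR; lra.
exists (\bigcup_k [set p | p \in L k]); last first.
  apply: esum_bigcup_seq_le (ltW e0) _ => [p|k]; first exact: expR_ge0.
  by have [_ _] := HL k.
split.
- by apply: bigcup_countable => // k _; exact/finite_set_countable/finite_seq.
- by move=> p [k _ /= pk]; have [h _ _] := HL k; exact: h.
- move=> y [k _ Zy]; have [_ h _] := HL k; have [p pL yp] := h y Zy.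
  by exists p => //; exists k.
Qed.

Lemma ucap_antitone eps : antitone_pos (fun delta => ereal_inf [set ucap_Z T phi Z eps
          | Z in [set Z | measurable Z /\ (mu Z >= (1 - delta)%:E)%E]]).
Proof.
move=> e e' e0 ee'; apply: ereal_inf_le_tmp => _ [Z [mZ hZ] <-]; exists Z => //.
by split=> //; apply: le_trans hZ; rewrite lee_fin; lra.
Qed.

Lemma lcap_antitone eps : antitone_pos (fun delta => ereal_inf [set lcap_Z T phi Z eps
          | Z in [set Z | measurable Z /\ (mu Z >= (1 - delta)%:E)%E]]).
Proof.
move=> e e' e0 ee'; apply: ereal_inf_le_tmp => _ [Z [mZ hZ] <-]; exists Z => //.
by split=> //; apply: le_trans hZ; rewrite lee_fin; lra.
Qed.

Lemma ucap_pressure_eps_le (b eps : R) : (S < b%:E)%E -> 0 < eps ->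
  (ucap_pressure_eps T mu phi eps <= b%:E)%E.
Proof.
move=> Sb eps0; apply: (elim0_le (ucap_antitone eps) ltr01) => del /andP[del0 _].
have [Z [N [mZ prZ h]]] := spanning_le dm dc cT sphi Tinv Terg Sb eps0 del0.
apply: (@le_trans _ _ (ucap_Z T phi Z eps)).
  by apply: ereal_inf_lbound; exists Z => //; split=> //; rewrite prE// lee_fin.
apply: (@limn_esup_le _ _ _ (maxn N 1)) => n; rewrite geq_max => /andP[Nn n0].
apply: elog_le => //; have [F ZF sF] := h n Nn.
apply: (@le_trans _ _ (\esum_(x in [set x | x \in F]) (expR (phi n x))%:E)%E).
  by apply: ereal_inf_lbound; exists [set x | x \in F] => //; split => //; exact/finite_set_countable/finite_seq.
apply: esum_le_seq => t ut tF; apply: le_trans sF.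
by apply: ler_sum_subseq => // x; exact: expR_ge0.
Qed.

Lemma lcap_le_ucap_eps eps : (lcap_pressure_eps T mu phi eps <= ucap_pressure_eps T mu phi eps)%E.
Proof.
apply: le_elim0; [exact: lcap_antitone|exact: ucap_antitone|] => e e0.
apply: le_ereal_inf_tmp => _ [Z hZ <-]; apply: le_trans (limn_einf_sup _).
by apply: ereal_inf_lbound; exists Z.
Qed.

Lemma span_ed_antitone delta : antitone_pos (fun eps => span_pressure_ed T mu phi eps delta).
Proof.
move=> e e' e0 ee'; apply: le_limn_esup => n.
apply: lee_wpmul2l; first by rewrite lee_fin invr_ge0.
apply: le_elog; apply: ereal_inf_le_tmp => _ [F hF <-]; exists F => //.
rewrite /spanning/= in hF *; apply: le_trans hF _.
have mb e1 : measurable (\bigcup_(x in [set x | x \in F]) bowen_ball d T n x e1 : set B).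
  by apply: measurable_seq_bigcup => x; exact: measurable_bowen_ball.
apply: le_measure; rewrite ?inE//.
by apply: subset_bigcup => x _; exact: bowen_ball_le.
Qed.

Lemma span_d_antitone : antitone_pos (span_pressure_d T mu phi).
Proof.
move=> e e' e0 ee'; apply: le_elim0; [exact: span_ed_antitone|exact: span_ed_antitone|].
move=> r r0; apply: le_limn_esup => n.
apply: lee_wpmul2l; first by rewrite lee_fin invr_ge0.
apply: le_elog; apply: ereal_inf_le_tmp => _ [F hF <-]; exists F => //.
by rewrite /spanning/= in hF *; apply: le_trans hF; rewrite lee_fin; lra.
Qed.

Lemma span_pressure_le (b : R) : (S < b%:E)%E -> (span_pressure T mu phi <= b%:E)%E.
Proof.
move=> Sb; apply: (elim0_le span_d_antitone ltr01) => del /andP[del0 _].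
apply: (elim0_le (span_ed_antitone del) ltr01) => eps /andP[eps0 _].
have [Z [N [mZ prZ h]]] := spanning_le dm dc cT sphi Tinv Terg Sb eps0 del0.
apply: (@limn_esup_le _ _ _ (maxn N 1)) => n; rewrite geq_max => /andP[Nn n0].
apply: elog_le => //; have [F ZF sF] := h n Nn.
apply: (@le_trans _ _ (\sum_(x <- F) expR (phi n x))%:E); last by rewrite lee_fin.
apply: ereal_inf_lbound; exists F => //; rewrite /spanning/= prE.
  by rewrite lee_fin (le_trans prZ)// le_pr_cover.
by apply: measurable_seq_bigcup => x; exact: measurable_bowen_ball.
Qed.

(** * Reduction of the other pressures to the Caratheodory pressure *)

Section LowerBounds.
Variables (a eps : R).
Hypothesis Ha : forall (Z : set B) (s : R), measurable Z -> 0 < pr mu Z ->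
  caram T phi Z s eps = 0%E -> a <= s.

Lemma cara_pressure_eps_ge : (a%:E <= cara_pressure_eps T mu phi eps)%E.
Proof.
apply: le_ereal_inf_tmp => _ [Z [mZ Z1] <-].
apply: le_ereal_inf_tmp => _ [s /= hs <-]; rewrite lee_fin.
by apply: Ha hs => //; rewrite /pr Z1.
Qed.

(** Were the capacity below some [r < a], covers of cost at most [exp (n r)] would exist for
    arbitrarily large [n]; at the midpoint [s] of [r] and [a] their weighted cost tends to 0, so
    [caram] would vanish at an exponent below [a]. *)
Lemma lcap_Z_ge Z : measurable Z -> 0 < pr mu Z -> (a%:E <= lcap_Z T phi Z eps)%E.
Proof.
move=> mZ Z0; rewrite leNgt; apply/negP => /lte_exists_real[r /andP[hr]].
rewrite lte_fin => ra; pose s := (r + a) / 2.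
have rs : 0 < s - r by rewrite /s; lra.
suff : a <= s by rewrite /s; lra.
apply: (Ha mZ Z0); apply: caram_eq0 => N e e0.
have [m Nm hm] := expRN_le (maxn N 1) rs e0.
have [n mn] := limn_einf_lt hr m.
have n1 : (maxn N 1 <= n)%N by exact: leq_trans mn.
move: n1; rewrite geq_max => /andP[Nn n0].
move=> /(elog_lt n0) /ereal_inf_lt[_ [C [cC ZC] <-] sC].
exists [set (x, n) | x in C].
  split.
  - exact: (card_le_trans (card_image_le _ _) cC).
  - by move=> _ [x _ <-].
  - by move=> y /ZC[x Cx xy]; exists (x, n) => //; exists x.
apply: esum_le_seq => t ut tC.
have tE : t = [seq (x, n) | x <- [seq p.1 | p <- t]].
  rewrite -map_comp -[LHS]map_id; apply/eq_in_map => p /tC[x _ <-] //.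
have ut1 : uniq [seq p.1 | p <- t] by rewrite tE in ut; exact: map_uniq ut.
rewrite tE -/(cost s); have := sum_cost s [seq p.1 | p <- t] n; rewrite /cost => ->.
have hC x : x \in [seq p.1 | p <- t] -> C x.
  by move=> /mapP[p /tC[y Cy <-] ->].
have := esum_seq_le ut1 hC (ltW sC); rewrite lee_fin => h.
apply: le_trans (ler_wpM2l (expR_ge0 _) h) _; apply: le_trans (hm n mn).
by rewrite -expRD ler_expR; lra.
Qed.

Lemma span_pressure_ed_ge delta : delta < 1 ->
  (a%:E <= span_pressure_ed T mu phi eps delta)%E.
Proof.
move=> del1; rewrite leNgt; apply/negP => /lte_exists_real[r /andP[hr]].
rewrite lte_fin => ra; pose s := (r + a) / 2.
have rs : 0 < s - r by rewrite /s; lra.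
suff : a <= s by rewrite /s; lra.
have [N0 HN0] := limn_esup_lt hr.
(* Along a sparse sequence of times the spanning sets have summable cost, while the
   upper limit of the sets they span still has measure at least [1 - delta]. *)
have /choice[n hn] : forall k : nat, exists n, (maxn k (maxn N0 1) <= n)%N /\
    expR (- (n%:R * (s - r))) <= 1 / 2 ^+ k.+1.
  move=> k; have p0 : 0 < 1 / 2 ^+ k.+1 :> R by rewrite divr_gt0// exprn_gt0.
  have [m Nm hm] := expRN_le (maxn k (maxn N0 1)) rs p0.
  by exists m; split => //; exact: hm.
have /choice[F HF] : forall k : nat, exists F : seq B,
    spanning T mu (n k) eps delta F /\ \sum_(x <- F) expR (phi (n k) x) <= expR ((n k)%:R * r).
  move=> k; have [] := hn k; rewrite !geq_max => /and3P[kn N0n n1] _.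
  have := elog_lt n1 (HN0 _ N0n) => /ereal_inf_lt[_ [F hF <-] /ltW]; rewrite lee_fin => h.
  by exists F.
pose U k : set B := \bigcup_(x in [set x | x \in F k]) bowen_ball d T (n k) x eps.
have mU k : measurable (U k).
  by apply: measurable_seq_bigcup => x; exact: measurable_bowen_ball.
have prU k : 1 - delta <= pr mu (U k).
  have [hs _] := HF k; rewrite -lee_fin -prE//; exact: hs.
pose W K := \bigcup_(k in [set k | (K <= k)%N]) U k.
have mW K : measurable (W K) by exact: bigcup_measurable.
have Wm i j : (i <= j)%N -> W j `<=` W i.
  by move=> ij x [k /= jk Ux]; exists k => //=; exact: leq_trans jk.
have mZ : measurable (\bigcap_K W K) by exact: bigcapT_measurable.
have prZ : 1 - delta <= pr mu (\bigcap_K W K).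
  apply/ler_addgt0Pr => e e0; have [K HK] := pr_bigcap_nonincreasing mu e0 mW Wm.
  apply: le_trans (ltW HK); apply: le_trans (prU K) _; apply: le_pr => //.
  by apply: bigcup_sup => /=.
apply: (Ha mZ); first by apply: lt_le_trans prZ; rewrite subr_gt0.
apply: caram_eq0 => N e e0.
have ln20 : 0 < ln 2 :> R by rewrite ln_gt0// ltr1n.
(* [K] is such that [2^(-K) <= e], with powers of 2 written as exponentials; at exponent [s] the
   spanning sets from index [K] on cost at most [2^(-K)] altogether. *)
have [K NK hK] := expRN_le N ln20 e0.
pose L j := [seq (x, n (K + j)%N) | x <- F (K + j)%N].
exists (\bigcup_j [set p | p \in L j]).
  split.
  - by apply: bigcup_countable => // k _; exact/finite_set_countable/finite_seq.
  - move=> p [k _ /= /mapP[x _ ->]] /=; have [] := hn (K + k)%N.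
    by rewrite geq_max => /andP[h _] _; lia.
  - move=> y /(_ K I)[k /= Kk [x /= xF xy]].
    exists (x, n k) => //; exists (k - K)%N => //=; rewrite /L subnKC//.
    exact: map_f.
have two : expR (- (K%:R * ln 2)) = 1 / 2 ^+ K :> R.
  by rewrite expRN mulrC expRM_natr lnK ?posrE// div1r.
apply: esum_bigcup_seq_le (ltW e0) _ => [p|j]; first exact: expR_ge0.
rewrite -/(cost s); have := sum_cost s (F (K + j)%N) (n (K + j)%N); rewrite /cost => ->.
have [_ sF] := HF (K + j)%N; have [_ hj] := hn (K + j)%N.
apply: le_trans (ler_wpM2l (expR_ge0 _) sF) _.
rewrite -expRD (_ : _ + _ = - ((n (K + j)%N)%:R * (s - r))); last by ring.
apply: le_trans hj _; rewrite -addnS exprD !div1r invfM ler_wpM2r//.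
by rewrite -div1r -two; exact: hK.
Qed.

End LowerBounds.

Lemma cara_pressureE : cara_pressure T mu phi = S.
Proof.
apply: eq_real_bounds => [b Sb|a aS].
  by apply: (eliminf0_le ltr01) => e /andP[e0 _]; exact: cara_pressure_eps_le.
have [e0 e00 h] := caratheodory_ge dm dc cT sphi Tinv Terg aS.
by apply: (eliminf0_ge e00) => e ee0; apply: cara_pressure_eps_ge; exact: h.
Qed.

Lemma lcap_pressure_eps_ge (a : R) : (a%:E < S)%E -> exists2 e0 : R, 0 < e0 &
  forall e, 0 < e < e0 -> (a%:E <= lcap_pressure_eps T mu phi e)%E.
Proof.
move=> aS; have [e0 e00 h] := caratheodory_ge dm dc cT sphi Tinv Terg aS.
exists e0 => // e ee0; apply: (elim0_ge (lcap_antitone e) ltr01).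
move=> del /andP[del0 del1]; apply: le_ereal_inf_tmp => _ [Z [mZ hZ] <-].
apply: (lcap_Z_ge (h e ee0) mZ).
have : 1 - del <= pr mu Z by rewrite -lee_fin -prE.
by apply: lt_le_trans; rewrite subr_gt0.
Qed.

Lemma lcap_pressureE : lcap_pressure T mu phi = S.
Proof.
apply: eq_real_bounds => [b Sb|a aS].
  apply: (eliminf0_le ltr01) => e /andP[e0 _]; apply: le_trans (lcap_le_ucap_eps e) _.
  exact: ucap_pressure_eps_le.
by have [e0 e00 h] := lcap_pressure_eps_ge aS; exact: (eliminf0_ge e00).
Qed.

Lemma ucap_pressureE : ucap_pressure T mu phi = S.
Proof.
apply: eq_real_bounds => [b Sb|a aS].
  by apply: (eliminf0_le ltr01) => e /andP[e0 _]; exact: ucap_pressure_eps_le.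
have [e0 e00 h] := lcap_pressure_eps_ge aS.
by apply: (eliminf0_ge e00) => e /h ha; exact: le_trans (lcap_le_ucap_eps e).
Qed.

Lemma span_pressureE : span_pressure T mu phi = S.
Proof.
apply: eq_real_bounds => [b|a aS]; first exact: span_pressure_le.
have [e0 e00 h] := caratheodory_ge dm dc cT sphi Tinv Terg aS.
apply: (elim0_ge span_d_antitone ltr01) => del /andP[del0 del1].
apply: (elim0_ge (span_ed_antitone del) e00) => e ee0.
exact: (span_pressure_ed_ge (h e ee0) del1).
Qed.

End Pressures.

Theorem theoremC (R : realType) (X : pointedType) (d : X -> X -> R)
  (T : Borel d -> Borel d) (phi : nat -> Borel d -> R) (mu : probability (Borel d) R) :
  is_metric d -> dcompact d -> dcontinuous_map d T ->
  supadditive_potential d T phi ->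
  T_invariant T mu -> T_ergodic T mu ->
  [/\ cara_pressure T mu phi = lcap_pressure T mu phi,
      lcap_pressure T mu phi = ucap_pressure T mu phi,
      ucap_pressure T mu phi = span_pressure T mu phi &
      span_pressure T mu phi = (ms_entropy T mu + Phi_star mu phi)%E].
Proof.
move=> dm dc cT sphi Tinv Terg.
have c := cara_pressureE dm dc cT sphi Tinv Terg.
have l := lcap_pressureE dm dc cT sphi Tinv Terg.
have u := ucap_pressureE dm dc cT sphi Tinv Terg.
have s := span_pressureE dm dc cT sphi Tinv Terg.
by split; [exact: etrans c (esym l)|exact: etrans l (esym u)|exact: etrans u (esym s)|].
Qed.
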